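(* Let $(G,F)$ be a framed graph and let $\mathrm{h}$ be an admissible height function for the framed triangulation $\Delta_{G,F}$. Then the Hasse diagram of the framing lattice $\mathscr{L}_{G,F}$ is (isomorphic as a graph to) the edge graph of the tropical framingtope $\mathscr{P}_{G,F}^{\mathrm{h}}$, i.e. the graph formed by its $0$-dimensional and $1$-dimensional cells.
   Context: Flow graphs and flow polytopes. A flow graph $G$ is a finite directed acyclic graph (multiple edges allowed) with vertex set $[n]=\{1,\dots,n\}$ and edge multiset $E(G)$, all edges directed from smaller to larger vertices, with unique source $1$ and unique sink $n$. For a vertex $v$, $\mathrm{In}(v)$ and $\mathrm{Out}(v)$ are its sets of incoming and outgoing edges. A route is a directed path from $1$ to $n$; $R(G)$ is the set of routes. The flow polytope $\mathcal{F}_G\subset\mathbb{R}^{E(G)}$ is the set of nonnegative $(x_e)_{e}$ with $\sum_{e\in \mathrm{Out}(j)}x_e-\sum_{e\in \mathrm{In}(j)}x_e=u_j$ for all $j$, where $u_1=1$, $u_n=-1$, $u_j=0$ otherwise. Its vertices are the $0/1$ indicator vectors of the routes. Framings and coherence. A framing $F$ of $G$ is a choice, at every vertex $v$, of linear orders on $\mathrm{In}(v)$ and on $\mathrm{Out}(v)$; $(G,F)$ is called a framed graph. For a path $P$ through $v$ let $Pv$ (resp. $vP$) be its maximal subpath ending (resp. beginning) at $v$. For paths $P,Q$ through $v$: let $w\le v$ be the smallest vertex after which $Pv$ and $Qv$ coincide; if $w$ is the first vertex of $Pv$ or $Qv$, then $Pv=_{\mathscr{I}(v)}Qv$; otherwise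 $Pv<_{\mathscr{I}(v)}Qv$ iff the edge of $P$ entering $w$ is smaller, in the order on $\mathrm{In}(w)$, than the edge of $Q$ entering $w$. Similarly, let $w'\ge v$ be the largest vertex before which $vP$ and $vQ$ coincide; if $w'$ is the last vertex of $vP$ or $vQ$, then $vP=_{\mathscr{O}(v)}vQ$; otherwise $vP<_{\mathscr{O}(v)}vQ$ iff the edge of $P$ leaving $w'$ is smaller, in the order on $\mathrm{Out}(w')$, than the edge of $Q$ leaving $w'$. Two routes $P,Q$ are incoherent at a common inner vertex $v$ ($v\ne 1,n$) if $Pv<_{\mathscr{I}(v)}Qv$ and $vQ<_{\mathscr{O}(v)}vP$, or $Qv<_{\mathscr{I}(v)}Pv$ and $vP<_{\mathscr{O}(v)}vQ$; they are coherent if they are incoherent at no common inner vertex. A clique is a set of pairwise coherent routes; a maximal clique is an inclusion-maximal one. Framed triangulation. For a clique $S$ let $\Delta_S$ be the convex hull of the indicator vectors of its routes. By Danilov–Karzanov–Koshevoy, the $\Delta_C$, $C$ a maximal clique, are the top-dimensional simplices of a regular unimodular triangulation $\Delta_{G,F}$ of $\mathcal{F}_G$ (the framed triangulation); its faces are the $\Delta_S$, $S$ a clique. Framing lattice. Let $C\neq C'$ be maximal cliques with $C'=(C\setminus\{R\})\cup\{R'\}$. Then $R,R'$ are incoherent at some vertex $v$. Write $R<^{\mathrm{cw}}_v R'$ if $Rv\leq_{\mathscr{I}(v)}R'v$ and $vR'\leq_{\mathscr{O}(v)}vR$ at such a vertex; in this case put $C\prec C'$. $\mathscr{L}_{G,F}$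 is the set of maximal cliques ordered by the reflexive-transitive closure of $\prec$; it is a lattice whose cover relation is $\prec$ (von Bell–Ceballos). Admissible height functions. A height function $\mathrm{h}:R(G)\to\mathbb{R}$ induces a regular subdivision of $\mathcal{F}_G$: lift the indicator vector of each $R$ to height $\mathrm{h}(R)$ and project the upper faces of the convex hull; equivalently, its faces are the convex hulls of the sets of routes minimizing $R\mapsto -\mathrm{h}(R)+\langle R,\mathbf{y}\rangle$ for $\mathbf{y}\in\mathbb{R}^{E(G)}$. $\mathrm{h}$ is admissible if this subdivision equals $\Delta_{G,F}$. Tropical arrangement. For $0\le i\le n-2$ label the outgoing edges of vertex $i+1$ by $e_{i,0},e_{i,1},\dots,e_{i,j_i}$ from bottom to top (drawing the framing as increasing from top to bottom, so in decreasing framing order). For each source edge $e_{0,i}$, $0\le i\le j_0$, let $\hat G_i$ be the smallest subgraph containing every route starting with $e_{0,i}$, and $G_i$ the graph obtained from $\hat G_i$ by deleting $e_{0,i}$ (its routes start at the head of $e_{0,i}$ and end at $n$). Let $I=\{(i,j):1\le i\le n-2,\ 1\le j\le j_i\}$; for a route $R$ let $\vec R\in\{0,1\}^I$ have $(i,j)$-coordinate $1$ iff $R$ uses $e_{i,j}$. For $\mathbf{x}\in\mathbb{R}^I$ put $$T_i^{\mathrm h}(\mathbf{x})=\min\{-\mathrm{h}(e_{0,i}R)+\langle \vec R,\mathbf{x}\rangle: R\in R(G_i)\},$$ where $e_{0,i}R$ is the route of $G$ obtained by prepending $e_{0,i}$ to $R$. $T_i^{\mathrm h}$ induces a polyhedral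 decomposition of $\mathbb{R}^I$ whose cells are the nonempty sets $\{\mathbf{x}: \text{every } R\in A \text{ attains the minimum}\}$, for nonempty $A\subseteq R(G_i)$. The tropical cell decomposition $\mathscr{T}^{\mathrm h}$ is the common refinement of these decompositions for $i=0,\dots,j_0$; its cells are the nonempty intersections of cells, one from each decomposition. The tropical framingtope $\mathscr{P}^{\mathrm h}_{G,F}$ is the polytopal complex of bounded cells of $\mathscr{T}^{\mathrm h}$. *)

(* Defs.v *)
From HB Require Import structures.
From mathcomp Require Import all_boot all_order all_algebra.
From mathcomp Require Import all_classical all_reals.

Set Implicit Arguments.
Unset Strict Implicit.
Unset Printing Implicit Defensive.

Import Order.TTheory GRing.Theory Num.Theory.

(* The vertices 1, ..., N of the mathematical text (N >= 2) are the elements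
   0, ..., n.+1 of 'I_n.+2, with N = n.+2. Since edges go from smaller to larger
   vertices, ord0 is always a source and ord_max always a sink. *)
Record flowGraph (n : nat) := FlowGraph {
  edge : finType;
  tail : edge -> 'I_n.+2;
  head : edge -> 'I_n.+2;
  tail_lt_head : forall e, (tail e < head e)%N;
  unique_source : forall v, v != ord0 -> exists e, head e = v;
  unique_sink : forall v, v != ord_max -> exists e, tail e = v
}.

Definition In n (G : flowGraph n) (v : 'I_n.+2) : {set edge G} :=
  [set e | head e == v]%SET.
Definition Out n (G : flowGraph n) (v : 'I_n.+2) : {set edge G} :=
  [set e | tail e == v]%SET.

Definition linear_order_on (T : finType) (A : {set T}) (r : rel T) : Prop :=
  [/\ {in A &, antisymmetric r}, {in A & &, transitive r} & {in A &, total r}].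

(* Only the restrictions of [frin v] to [In v] and of [frout v] to [Out v]
   matter below. *)
Record framing n (G : flowGraph n) := Framing {
  frin : 'I_n.+2 -> rel (edge G);
  frout : 'I_n.+2 -> rel (edge G);
  frin_linear : forall v, linear_order_on (In G v) (frin v);
  frout_linear : forall v, linear_order_on (Out G v) (frout v)
}.

Fixpoint walk n (G : flowGraph n) (u : 'I_n.+2) (p : seq (edge G))
    (v : 'I_n.+2) : bool :=
  if p is e :: q then (tail e == u) && walk (head e) q v else u == v.

Lemma walk_size n (G : flowGraph n) (p : seq (edge G)) u v :
  walk u p v -> (size p + u <= v)%N.
Proof.
elim: p u => [|e p IHp] u /=; first by move=> /eqP ->.
move=> /andP[/eqP <- /IHp]; apply: leq_trans.
by rewrite addSnnS leq_add2l tail_lt_head.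
Qed.

Lemma walk_size_max n (G : flowGraph n) (p : seq (edge G)) u v :
  walk u p v -> (size p <= n.+1)%N.
Proof.
move=> /walk_size sp; rewrite -ltnS (leq_ltn_trans _ (ltn_ord v)) //.
by rewrite (leq_trans _ sp) // leq_addr.
Qed.

(* By [walk_size_max] the bound n.+1 on the number of edges loses nothing; it
   only makes the type of routes finite. *)
Definition route n (G : flowGraph n) :=
  {p : {bseq n.+1 of edge G} | walk ord0 p ord_max}.

Definition edges_of n (G : flowGraph n) (P : route G) : seq (edge G) :=
  val (val P).

Section Coherence.
Variables (n : nat) (G : flowGraph n) (F : framing G).
Implicit Types (P Q : route G) (v : 'I_n.+2).

Definition visits P v : bool := v \in ord0 :: map (@head n G) (edges_of P).

(* Vertices increase along a route, so for v on P these filters select the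
   maximal subpaths Pv and vP of P ending, respectively starting, at v. *)
Definition path_to P v : seq (edge G) := [seq e <- edges_of P | head e <= v]%N.
Definition path_from P v : seq (edge G) := [seq e <- edges_of P | v <= tail e]%N.

Fixpoint first_diff (T : eqType) (s t : seq T) : option (T * T) :=
  match s, t with
  | a :: s', b :: t' => if a == b then first_diff s' t' else Some (a, b)
  | _, _ => None
  end.

(* Reading Pv and Qv backwards from v, the first differing edges are those
   entering the vertex w after which Pv and Qv coincide; there are none exactly
   when w is the first vertex of Pv or of Qv. *)
Definition in_diff v P Q :=
  first_diff (rev (path_to P v)) (rev (path_to Q v)).
Definition out_diff v P Q := first_diff (path_from P v) (path_from Q v).

Definition in_eq v P Q : bool := in_diff v P Q == None.
Definition in_lt v P Q : bool :=
  if in_diff v P Q is Some (a, b) then frin F (head a) a b else false.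
Definition in_le v P Q : bool := in_lt v P Q || in_eq v P Q.

Definition out_eq v P Q : bool := out_diff v P Q == None.
Definition out_lt v P Q : bool :=
  if out_diff v P Q is Some (a, b) then frout F (tail a) a b else false.
Definition out_le v P Q : bool := out_lt v P Q || out_eq v P Q.

Definition incoherent_at v P Q : bool :=
  [&& v != ord0, v != ord_max, visits P v, visits Q v
    & (in_lt v P Q && out_lt v Q P) || (in_lt v Q P && out_lt v P Q)].

Definition coherent P Q : bool := [forall v, ~~ incoherent_at v P Q].

Definition clique (S : {set route G}) : bool :=
  [forall P in S, forall Q in S, coherent P Q].

Definition maxclique := {C : {set route G} | maxset clique C}.

Definition cw v P Q : bool :=
  [&& incoherent_at v P Q, in_le v P Q & out_le v Q P].

Definition flip_lt : rel maxclique := fun C C' =>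
  [exists R in val C, exists R' : route G, exists v,
    [&& val C' != val C, val C' == (R' |: (val C :\ R))%SET & cw v R R']].

Definition framing_le : rel maxclique := connect flip_lt.
Definition framing_lt : rel maxclique := fun C C' =>
  (C != C') && framing_le C C'.
Definition framing_cover : rel maxclique := fun C C' =>
  framing_lt C C' && [forall D, ~~ (framing_lt C D && framing_lt D C')].

Definition hasse_adj : rel maxclique := fun C C' =>
  framing_cover C C' || framing_cover C' C.

End Coherence.

Local Open Scope ring_scope.
Local Open Scope classical_set_scope.

Section Triangulation.
Variables (R : realType) (n : nat) (G : flowGraph n) (F : framing G).
Implicit Types (h : route G -> R) (y : {ffun edge G -> R}).

Definition indicator (P : route G) : {ffun edge G -> R} :=
  [ffun e => (e \in edges_of P)%:R].

Definition route_hull (S : {set route G}) : set {ffun edge G -> R} :=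
  fun z => exists w : route G -> R,
    [/\ forall P, 0 <= w P,
        forall P, P \notin S -> w P = 0,
        \sum_P w P = 1
      & forall e, z e = \sum_P w P * indicator P e].

Definition lifted_value h y (P : route G) : R :=
  - h P + \sum_e indicator P e * y e.

Definition minimizers h y : {set route G} :=
  finset (fun P => [forall Q, lifted_value h y P <= lifted_value h y Q]).

Definition regular_subdivision h : set (set {ffun edge G -> R}) :=
  range (fun y => route_hull (minimizers h y)).

(* The empty face is left out on both sides of the equality in [admissible]:
   sets of minimizers are never empty. *)
Definition framed_triangulation : set (set {ffun edge G -> R}) :=
  fun D => exists S : {set route G},
    [/\ S != finset.set0, clique F S & D = route_hull S].

Definition admissible h : Prop := regular_subdivision h = framed_triangulation.

End Triangulation.

Section Tropical.
Variables (R : realType) (n : nat) (G : flowGraph n) (F : framing G).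
Implicit Types (h : route G -> R).

(* The outgoing edges of a vertex are numbered from 0 in decreasing framing
   order, so that the number of e in e_{i,0}, e_{i,1}, ... is the number of edges
   of Out (tail e) that are larger than e. *)
Definition out_label (e : edge G) : nat :=
  #|finset (fun e' => [&& e' \in Out G (tail e), e' != e
                        & frout F (tail e) e e'])|.

(* The set I of pairs (i,j) with i, j >= 1, as the set of the edges e_{i,j}. *)
Definition trop_index :=
  {e : edge G | (tail e != ord0) && (0 < out_label e)%N}.

Definition trop_point := {ffun trop_index -> R^o}.

Definition source_edge := {a : edge G | tail a == ord0}.

(* The edges of G_i, where e_{0,i} = a. *)
Definition tail_graph (a : source_edge) : {set edge G} :=
  (finset (fun e => [exists P : route G,
      (ohead (edges_of P) == Some (val a)) && (e \in edges_of P)]) :\ val a)%SET.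

Definition tail_route (a : source_edge) :=
  {p : {bseq n.+1 of edge G}
     | walk (head (val a)) p ord_max && all (mem (tail_graph a)) p}.

Lemma prepend_walk (a : source_edge) (p : tail_route a) :
  walk ord0 (val a :: val (val p)) ord_max.
Proof. by case: p => p /= /andP[-> _]; rewrite (valP a). Qed.

Definition prepend (a : source_edge) (p : tail_route a) : route G :=
  exist _ (Bseq (walk_size_max (prepend_walk p))) (prepend_walk p).

Definition trop_term h (a : source_edge) (x : trop_point) (p : tail_route a) : R :=
  - h (prepend p) + \sum_i (val i \in (val (val p) : seq (edge G)))%:R * x i.

Definition attains_min h (a : source_edge) (x : trop_point) (p : tail_route a) :=
  forall q : tail_route a, trop_term h x p <= trop_term h x q.

(* The cells of the polyhedral decomposition induced by T_i, e_{0,i} = a. *)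
Definition trop_decomposition h (a : source_edge) : set (set trop_point) :=
  fun c => c !=set0 /\ exists2 A : {set tail_route a}, A != finset.set0 &
    c = (fun x => forall p, p \in A -> attains_min h x p).

Definition trop_cells h : set (set trop_point) :=
  fun c => c !=set0 /\ exists2 D : source_edge -> set trop_point,
    (forall a, trop_decomposition h a (D a)) & c = \bigcap_a D a.

Definition bounded_pts (c : set trop_point) : Prop :=
  exists M : R, forall x, c x -> forall i, `|x i| <= M.

Definition framingtope h : set (set trop_point) :=
  fun c => trop_cells h c /\ bounded_pts c.

(* c is nonempty and the direction of its affine hull, i.e. the least subspace
   containing all differences with a given point of c, has dimension d. *)
Definition has_dim (c : set trop_point) (d : nat) : Prop :=
  exists2 x0, c x0 & exists2 V : {vspace trop_point}, \dim V = d &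
    forall W : {vspace trop_point},
      (V <= W)%VS <-> (forall x, c x -> x - x0 \in W).

Definition framingtope_cells h (d : nat) : set (set trop_point) :=
  fun c => framingtope h c /\ has_dim c d.

Definition framingtope_adj h (c c' : set trop_point) : Prop :=
  c <> c' /\ exists e, [/\ framingtope_cells h 1 e, c `<=` e & c' `<=` e].

End Tropical.

(* Main.v *)
Require Import Defs.
From mathcomp Require Import all_boot all_order all_algebra.
From mathcomp Require Import all_classical all_reals.
From mathcomp Require Import ring lra.

Set Implicit Arguments.
Unset Strict Implicit.
Unset Printing Implicit Defensive.

Import Order.TTheory GRing.Theory Num.Theory.
Import Defs.

(** The bridge between the two sides is the set [argmin x] of the routes that
    minimize [- h + <., x>] among all routes with the same first edge.

    Gauge. Adding [phi (head e) - phi (tail e)] to the weight of every edge [e]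
    changes the weights of all routes by the same constant, and a potential
    [phi] that vanishes at the sink and is determined at the inner vertices
    removes the weights of the edges labelled 0 outside the source. Hence the
    points of the tropical arrangement are the linear functionals on the flow
    polytope up to the weights of the source edges, which shift all routes with
    a given first edge together ([gauge], [ungauge]). Since routes are the
    vertices of the polytope, a face determines its routes, and admissibility
    says that the sets [argmin x] are exactly the cliques with a route through
    each source edge ([clique_argmin], [clique_point]). The cells of the
    tropical decomposition are the sets [cell S] of all [x] with [S] included
    in [argmin x], for such cliques [S] ([trop_cellsP]).

    Vertices. Let [C] be a maximal clique, [argmin x = C], and let [d] be a
    direction along which the routes of [C] with a common source keep equal
    weights. If some other route had a different slope along [d], moving from
    [x] along [d] or [- d] until a new route becomes minimal would produce a
    clique strictly containing [C]; so all routes with a common source have the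
    same slope, which forces [d = 0] ([maxclique_rigid]). Thus the cell of [C]
    is a point, and these points are the vertices of the framingtope
    ([framingtope_vertexP]).

    Edges. Rigidity also shows that, when [C] and [C'] differ by exchanging one
    route, their intersection still has a route through each source edge, its
    cell is the segment between the two vertices ([exchange_segment]), and no
    third maximal clique contains it ([exchange_cliques]). Conversely the
    maximal cliques of two vertices lying on a 1-dimensional cell differ by one
    exchange ([adjacent_exchange]).

    Flips are covers. It remains to see that no chain of flips from [C] to [C']
    shortcuts a flip. A route [P] outside a maximal clique is incoherent with
    some member [Q], which is above [P] if [cw v P Q] holds at some [v], and
    below [P] if [cw v Q P] does. Having a member above [P] is preserved by
    flips upwards, and having one below [P] by flips downwards
    ([has_above_flip], [has_below_flip]): if the member [R] is exchanged for
    [R'], incoherent with [R] at [w], its role is taken over by [R'] or by one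
    of the two routes obtained by switching between [R] and [R'] at [w]. These
    are coherent with the common part of the two cliques, hence belong to it,
    as no third maximal clique contains that part. Therefore all cliques in the
    interval between [C] and [C'] contain their intersection, so that the
    interval is [C], [C'] ([flip_lt_cover]). *)

(** * First differences and lexicographic comparison *)

Section FirstDiff.
Variable T : eqType.
Implicit Types s t u : seq T.

Lemma first_diff_refl s : first_diff s s = None.
Proof. by elim: s => //= a s ->; rewrite eqxx. Qed.

Lemma first_diff_sym s t :
  first_diff t s = omap (fun ab => (ab.2, ab.1)) (first_diff s t).
Proof.
elim: s t => [|a s IHs] [|b t] //=; rewrite eq_sym.
by case: eqVneq => //= _; apply: IHs.
Qed.

Lemma first_diff_cat2 s t u : first_diff (u ++ s) (u ++ t) = first_diff s t.
Proof. by elim: u => //= a u ->; rewrite eqxx. Qed.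

(** A difference from [t ++ u] is found either after the whole of [t], or
    inside [t], where what follows [t] is not seen. *)
Lemma first_diff_catr s t u x :
  first_diff s (t ++ u) = Some x ->
  (exists2 s', s = t ++ s' & first_diff s' u = Some x)
  \/ (forall u', first_diff s (t ++ u') = Some x).
Proof.
elim: t s => [|b t IHt] s /=; first by left; exists s.
case: s => [|a s] //=; case: eqVneq => [->|nab]; last by right.
by case/IHt => [[s' -> dx]|dx]; [left; exists s'|right].
Qed.

End FirstDiff.

(** The orders on paths compare the two edges after which the paths part. These
    edges share an endpoint, [key], whose linear order applies; reading on
    along the path moves to the other endpoint, [next]. Reading forwards gives
    the order on outgoing paths, reading backwards that on incoming paths. *)
Section Lexicographic.
Variables (E V : eqType) (key next : E -> V) (r : V -> rel E).
Hypothesis r_anti : forall a b, key a = key b ->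
  r (key a) a b -> r (key a) b a -> a = b.
Hypothesis r_trans : forall a b c, key a = key b -> key b = key c ->
  r (key a) a b -> r (key a) b c -> r (key a) a c.

Fixpoint chain v s :=
  if s is e :: s' then (key e == v) && chain (next e) s' else true.

Definition lex s t :=
  if first_diff s t is Some (a, b) then r (key a) a b else false.

Lemma lex_asym v s t : chain v s -> chain v t -> lex s t -> lex t s = false.
Proof.
rewrite /lex; elim: s v t => [|a s IHs] v [|b t] //= /andP[/eqP ka cs].
move=> /andP[/eqP kb ct]; move: cs ct; rewrite [b == a]eq_sym.
case: (eqVneq a b) => [-> cs ct|nab _ _ rab]; first exact: IHs cs ct.
apply/negP => rba; case/eqP: nab; apply: r_anti => //; first by rewrite ka.
by rewrite ka -kb.
Qed.

Lemma lex_trans v s t u : chain v s -> chain v t -> chain v u ->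
  lex s t -> lex t u -> lex s u.
Proof.
rewrite /lex; elim: s v t u => [|a s IHs] v [|b t] // [|c u] //=.
move=> /andP[/eqP ka cs] /andP[/eqP kb ct] /andP[/eqP kc cu].
move: cs ct cu.
case: (eqVneq a b) => [->|nab] cs ct cu.
  case: (eqVneq b c) cs ct cu => [-> cs ct cu|nbc cs ct cu _] //.
  exact: IHs cs ct cu.
case: (eqVneq b c) => [<-|nbc]; first by rewrite (negPf nab).
move=> rab rbc.
have kab : key a = key b by rewrite ka kb.
have kbc : key b = key c by rewrite kb kc.
case: (eqVneq a c) => [ac|nac]; last by apply: r_trans rab _; rewrite // kab.
case/eqP: nab; apply: r_anti => //.
by rewrite kab [X in r _ _ X]ac.
Qed.

End Lexicographic.

(** * Walks, routes and their splittings at a vertex *)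
Section Routes.
Variables (n : nat) (G : flowGraph n).
Implicit Types (P Q X Z : route G) (p q : seq (edge G)) (u v w : 'I_n.+2).

Lemma walk_catP u p q v : reflect
  (exists2 w, walk u p w & walk w q v) (walk u (p ++ q) v).
Proof.
elim: p u => [|e p IHp] u /=.
  apply: (iffP idP) => [uv|[w /eqP <- //]]; by exists u.
apply: (iffP andP) => [[te /IHp [w wp wq]]|[w /andP[te wp] wq]].
  by exists w; rewrite ?te.
by split=> //; apply/IHp; exists w.
Qed.

Lemma walk_unique_end u p v v' : walk u p v -> walk u p v' -> v = v'.
Proof.
elim: p u => [|e p IHp] u /= => [/eqP <- /eqP //|/andP[_ wp] /andP[_]].
exact: IHp wp.
Qed.

Lemma walk_le u p v : walk u p v -> (u <= v)%N.
Proof. by move=> /walk_size; apply: leq_trans; apply: leq_addl. Qed.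

Lemma walk_tail u p v e : walk u p v -> e \in p -> (u <= tail e)%N.
Proof.
elim: p u => //= a p IHp u /andP[/eqP <- wp]; rewrite inE => /predU1P[-> //|ep].
apply: leq_trans (IHp _ wp ep); exact/ltnW/tail_lt_head.
Qed.

Lemma walk_head u p v e : walk u p v -> e \in p -> (head e <= v)%N.
Proof.
elim: p u => //= a p IHp u /andP[_ wp]; rewrite inE => /predU1P[->|ep].
  exact: walk_le wp.
exact: IHp wp ep.
Qed.

Lemma walk_notin e p v : walk (head e) p v -> e \notin p.
Proof.
move=> wp; apply/negP => /(walk_tail wp); rewrite leqNgt => /negP; apply.
exact: tail_lt_head.
Qed.

Lemma walk_uniq u p v : walk u p v -> uniq p.
Proof.
elim: p u => //= e p IHp u /andP[_ wp]; rewrite (IHp _ wp) andbT.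
exact: walk_notin wp.
Qed.

Lemma walk_nil u p : walk u p u -> p = [::].
Proof.
by move=> /walk_size; rewrite -{2}[(u : nat)]add0n leq_add2r leqn0 => /nilP.
Qed.

(** Vertices increase along a walk, so a walk cannot use only part of the edges
    of another one with the same ends: at the first edge that differs it would
    have to use an edge starting further on. *)
Lemma walk_subset u p q v : walk u p v -> walk u q v -> {subset q <= p} ->
  q = p.
Proof.
elim: p u q => [|e p IHp] u q.
  by move=> /= /eqP -> wq _; apply: walk_nil wq.
case: q => [|a q] wp wq sqp; first by case/eqP: wq wp => -> /walk_nil.
case/andP: (wp) (wq) => /eqP te wp' /andP[/eqP ta wq'].
have ae : a = e.
  have := sqp a (mem_head _ _); rewrite inE => /predU1P[//|ap].
  have := walk_tail wp' ap; rewrite ta -te leqNgt; case/negP.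
  exact: tail_lt_head.
rewrite ae in wq' sqp *; congr cons; apply: (IHp _ _ wp' wq') => b bq.
have := sqp b (mem_behead (s := e :: q) bq); rewrite inE => /predU1P[be|//].
by case/negP: (walk_notin wq'); rewrite -be.
Qed.

Lemma walk_chain u p v : walk u p v -> chain (@tail n G) (@head n G) u p.
Proof. by elim: p u => //= e p IHp u /andP[-> /IHp]. Qed.

Lemma walk_rev_chain u p v :
  walk u p v -> chain (@head n G) (@tail n G) v (rev p).
Proof.
elim/last_ind: p v => [//|p e IHp] v; rewrite -cats1.
case/walk_catP=> w wp /= /andP[/eqP te /eqP <-].
by rewrite rev_cat /= eqxx te IHp.
Qed.

Lemma edges_of_walk P : walk ord0 (edges_of P) ord_max.
Proof. exact: valP P. Qed.

Lemma edges_of_uniq P : uniq (edges_of P).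
Proof. exact: walk_uniq (edges_of_walk P). Qed.

Lemma edges_of_inj : injective (@edges_of n G).
Proof. by move=> P Q ePQ; do 2!apply: val_inj. Qed.

Lemma walk_route p : walk ord0 p ord_max -> exists P, edges_of P = p.
Proof. by move=> wp; exists (exist _ (Bseq (walk_size_max wp)) wp). Qed.

(** The pieces of a route at [v] are characterized by being walks that end and
    start at [v]; this avoids any reasoning on the filters defining them. *)
Lemma path_splitE P v p q : edges_of P = p ++ q -> walk ord0 p v ->
  walk v q ord_max -> [/\ visits P v, path_to P v = p & path_from P v = q].
Proof.
move=> eP wp wq; rewrite /visits /path_to /path_from eP; split.
- elim: p {eP} ord0 wp => [|e p IHp] u /=.
    by move/eqP ->; rewrite mem_head.
  by case/andP=> _ /IHp; rewrite !inE => ->; rewrite orbT.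
- rewrite filter_cat (all_filterP _) ?(eq_in_filter (a2 := pred0)).
  + by rewrite filter_pred0 cats0.
  + move=> e eq /=; apply/negbTE; rewrite -ltnNge.
    exact: leq_ltn_trans (walk_tail wq eq) (tail_lt_head e).
  + by apply/allP => e; apply: walk_head wp.
- rewrite filter_cat (eq_in_filter (a2 := pred0)) ?filter_pred0 /=; last first.
    move=> e ep /=; apply/negbTE; rewrite -ltnNge.
    exact: leq_trans (tail_lt_head e) (walk_head wp ep).
  by apply/all_filterP/allP => e; apply: walk_tail wq.
Qed.

Lemma visits_split P v : visits P v ->
  [/\ edges_of P = path_to P v ++ path_from P v, walk ord0 (path_to P v) v
    & walk v (path_from P v) ord_max].
Proof.
move=> vP; suff [p [q [eP wp wq]]] : exists p q,
    [/\ edges_of P = p ++ q, walk ord0 p v & walk v q ord_max].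
  by case: (path_splitE eP wp wq) => _ -> ->.
move: vP (edges_of_walk P); rewrite /visits.
elim: (edges_of P) ord0 => [|e p IHp] u /=.
  by rewrite inE => /eqP -> u_max; exists [::], [::]; rewrite /= eqxx.
rewrite inE; case: eqVneq => [-> _ wp|_ /= vp /andP[te wp]].
  by exists [::], (e :: p); rewrite /= eqxx.
have [p1 [p2 [-> w1 w2]]] := IHp _ vp wp.
by exists (e :: p1), p2; rewrite /= te.
Qed.

Lemma visits_between P v w : visits P v -> visits P w -> (v <= w)%N ->
  exists m, path_to P w = path_to P v ++ m
    /\ path_from P v = m ++ path_from P w.
Proof.
move=> vP wP vw; have [eP w1 w2] := visits_split vP.
have [eP' w3 w4] := visits_split wP.
exists [seq e <- path_from P v | head e <= w]%N.
have eto : path_to P w =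
    path_to P v ++ [seq e <- path_from P v | head e <= w]%N.
  rewrite {1}/path_to eP filter_cat.
  rewrite (_ : seq.filter _ (path_to P v) = path_to P v) //.
  by apply/all_filterP/allP => e /(walk_head w1) /leq_trans; apply.
split=> //; move/eqP: eP'; rewrite eP eto -catA eqseq_cat // eqxx.
by move/eqP.
Qed.

Lemma splice P Q v : visits P v -> visits Q v -> exists X,
  [/\ visits X v, path_to X v = path_to P v & path_from X v = path_from Q v].
Proof.
move=> /visits_split[_ wp _] /visits_split[_ _ wq].
have [X eX] : exists X, edges_of X = path_to P v ++ path_from Q v.
  by apply: walk_route; apply/walk_catP; exists v.
by exists X; apply: path_splitE eX wp wq.
Qed.

(** Suppose [Q] and [Z] meet at [v], and that they part on both sides of [v].
    Let [w] be another vertex of [Z]. If the common piece of [Q] and [Z] around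
    [v] stops before [w], the situation at [v] only depends on [Z] up to [w];
    if it starts after [w], only on [Z] from [w] on; otherwise [w] lies on the
    common piece, and the two routes part at the same edges seen from [w] as
    from [v]. *)
Lemma diff_transfer v w Q Z s t :
  visits Q v -> visits Z v -> visits Z w ->
  in_diff v Q Z = Some s -> out_diff v Q Z = Some t ->
  [\/ forall Z', visits Z' w -> path_to Z' w = path_to Z w ->
        [/\ visits Z' v, in_diff v Q Z' = Some s & out_diff v Q Z' = Some t],
      forall Z', visits Z' w -> path_from Z' w = path_from Z w ->
        [/\ visits Z' v, in_diff v Q Z' = Some s & out_diff v Q Z' = Some t]
    | [/\ visits Q w, in_diff w Q Z = Some s & out_diff w Q Z = Some t]].
Proof.
rewrite /in_diff /out_diff => vQ vZ wZ dI dO.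
have [eQ wQ1 wQ2] := visits_split vQ; have [eZ wZ1 wZ2] := visits_split vZ.
have [eZ' wZ3 wZ4] := visits_split wZ.
case: (leqP v w) => [vw|/ltnW wv].
  (* m is the piece of Z from v to w; it may or may not be followed by Q. *)
  have [m [em1 em2]] := visits_between vZ wZ vw.
  have wm : walk v m w.
    by move: wZ3; rewrite em1 => /walk_catP[x /(walk_unique_end wZ1) <-].
  move: dO; rewrite em2 => /first_diff_catr [[q eq dO]|dO].
    constructor 3.
    have [] := @path_splitE Q w (path_to Q v ++ m) q.
    - by rewrite -catA -eq.
    - by apply/walk_catP; exists v.
    - by move: wQ2; rewrite eq => /walk_catP[x /(walk_unique_end wm) <-].
    move=> -> -> ->; split=> //.
    by rewrite em1 !rev_cat first_diff_cat2.
  constructor 1 => Z' wZ' e1; have [e2 _ w5] := visits_split wZ'.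
  have [] := @path_splitE Z' v (path_to Z v) (m ++ path_from Z' w).
  - by rewrite catA -em1 -e1.
  - by [].
  - by apply/walk_catP; exists w.
  by move=> -> -> ->.
have [m [em1 em2]] := visits_between wZ vZ wv.
have wm : walk w m v.
  by move: wZ1; rewrite em1 => /walk_catP[x /(walk_unique_end wZ3) <-].
move: dI; rewrite em1 rev_cat => /first_diff_catr [[q eq dI]|dI].
  constructor 3.
  have eq' : path_to Q v = rev q ++ m by rewrite -[LHS]revK eq rev_cat revK.
  have [] := @path_splitE Q w (rev q) (m ++ path_from Q v).
  - by rewrite catA -eq'.
  - move: wQ1; rewrite eq' => /walk_catP [x wx wm'].
    have -> // : w = x.
    have := walk_rev_chain wm; have := walk_rev_chain wm'.
    case: (m) wm wm' => [|e m'] /=; first by move=> /eqP <- /eqP <-.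
    by case/andP=> /eqP <- _ /andP[/eqP <-].
  - by apply/walk_catP; exists v.
  move=> -> -> ->; split=> //; first by rewrite revK.
  by rewrite em2 first_diff_cat2.
constructor 2 => Z' wZ' e1; have [e2 w5 _] := visits_split wZ'.
have [] := @path_splitE Z' v (path_to Z' w ++ m) (path_from Z v).
- by rewrite -catA -em2 -e1.
- by apply/walk_catP; exists w.
- by [].
by move=> -> -> ->; rewrite rev_cat; split.
Qed.

End Routes.

(** * Coherence of routes *)
Section Coherence.
Variables (n : nat) (G : flowGraph n) (F : framing G).
Implicit Types (P Q A B X Z : route G) (u v w : 'I_n.+2).

Lemma in_ltE v P Q : in_lt F v P Q =
  lex (@head n G) (frin F) (rev (path_to P v)) (rev (path_to Q v)).
Proof. by []. Qed.

Lemma out_ltE v P Q :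
  out_lt F v P Q = lex (@tail n G) (frout F) (path_from P v) (path_from Q v).
Proof. by []. Qed.

Lemma frin_anti (a b : edge G) : head a = head b ->
  frin F (head a) a b -> frin F (head a) b a -> a = b.
Proof.
have [anti _ _] := frin_linear F (head a) => hab ab ba.
by apply: anti; rewrite ?inE ?hab //; apply/andP; split; rewrite -?hab.
Qed.

Lemma frin_trans (a b c : edge G) : head a = head b -> head b = head c ->
  frin F (head a) a b -> frin F (head a) b c -> frin F (head a) a c.
Proof.
have [_ trans _] := frin_linear F (head a) => hab hbc.
by apply: trans; rewrite ?inE -?hbc -?hab.
Qed.

Lemma frout_anti (a b : edge G) : tail a = tail b ->
  frout F (tail a) a b -> frout F (tail a) b a -> a = b.
Proof.
have [anti _ _] := frout_linear F (tail a) => hab ab ba.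
by apply: anti; rewrite ?inE ?hab //; apply/andP; split; rewrite -?hab.
Qed.

Lemma frout_trans (a b c : edge G) : tail a = tail b -> tail b = tail c ->
  frout F (tail a) a b -> frout F (tail a) b c -> frout F (tail a) a c.
Proof.
have [_ trans _] := frout_linear F (tail a) => hab hbc.
by apply: trans; rewrite ?inE -?hbc -?hab.
Qed.

Lemma in_lt_asym v P Q : visits P v -> visits Q v ->
  in_lt F v P Q -> in_lt F v Q P = false.
Proof.
move=> /visits_split[_ /walk_rev_chain wP _].
move=> /visits_split[_ /walk_rev_chain wQ _].
rewrite !in_ltE; exact: lex_asym frin_anti _ _ _ wP wQ.
Qed.

Lemma in_lt_trans v P Q X : visits P v -> visits Q v -> visits X v ->
  in_lt F v P Q -> in_lt F v Q X -> in_lt F v P X.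
Proof.
move=> /visits_split[_ /walk_rev_chain wP _].
move=> /visits_split[_ /walk_rev_chain wQ _].
move=> /visits_split[_ /walk_rev_chain wX _].
rewrite !in_ltE; exact: lex_trans frin_anti frin_trans _ _ _ _ wP wQ wX.
Qed.

Lemma out_lt_trans v P Q X : visits P v -> visits Q v -> visits X v ->
  out_lt F v P Q -> out_lt F v Q X -> out_lt F v P X.
Proof.
move=> /visits_split[_ _ /walk_chain wP] /visits_split[_ _ /walk_chain wQ].
move=> /visits_split[_ _ /walk_chain wX].
rewrite !out_ltE; exact: lex_trans frout_anti frout_trans _ _ _ _ wP wQ wX.
Qed.

Lemma path_to_ord0 P : path_to P ord0 = [::].
Proof.
have vP : visits P ord0 by rewrite /visits mem_head.
by have [_ /walk_nil] := visits_split vP.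
Qed.

Lemma path_from_max P : path_from P ord_max = [::].
Proof.
have [|_ _ -> //] :=
  path_splitE (esym (cats0 _)) (edges_of_walk P) (v := ord_max).
by rewrite /= eqxx.
Qed.

Lemma in_diff_sym v P Q :
  in_diff v Q P = omap (fun ab => (ab.2, ab.1)) (in_diff v P Q).
Proof. exact: first_diff_sym. Qed.

Lemma out_diff_sym v P Q :
  out_diff v Q P = omap (fun ab => (ab.2, ab.1)) (out_diff v P Q).
Proof. exact: first_diff_sym. Qed.

(** The weak inequalities in the definition of [cw] select one of the two cases
    of incoherence, in which both are strict. *)
Lemma cwE v P Q : cw F v P Q =
  [&& visits P v, visits Q v, in_lt F v P Q & out_lt F v Q P].
Proof.
apply/idP/idP.
  case/and3P=> /and5P[_ _ vP vQ inc] inle outle; rewrite vP vQ /=.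
  case/orP: inc => [//|/andP[inQP outPQ]].
  case/orP: inle => [inPQ|]; first by rewrite (in_lt_asym vP vQ inPQ) in inQP.
  rewrite /in_eq => /eqP d; move: inQP.
  by rewrite /in_lt in_diff_sym d.
case/and4P=> vP vQ inPQ outQP; rewrite /cw /incoherent_at vP vQ /in_le /out_le.
rewrite inPQ outQP !andbT /=; apply/andP; split; apply/negP => /eqP v0.
  by move: inPQ; rewrite v0 /in_lt /in_diff !path_to_ord0.
by move: outQP; rewrite v0 /out_lt /out_diff !path_from_max.
Qed.

Lemma incoherent_cw v P Q : incoherent_at F v P Q = cw F v P Q || cw F v Q P.
Proof.
apply/idP/orP => [inc|[]]; last 2 first.
- by case/and3P.
- by case/and3P=> + _ _; rewrite /incoherent_at orbC => /and5P[-> -> -> -> ->].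
by case/and5P: inc => _ _ vP vQ; rewrite !cwE vP vQ => /orP.
Qed.

Lemma coherentP P Q :
  reflect (forall v, cw F v P Q = false /\ cw F v Q P = false) (coherent F P Q).
Proof.
apply: (iffP forallP) => cPQ v; have := cPQ v; rewrite incoherent_cw.
  by rewrite negb_or => /andP[/negbTE -> /negbTE ->].
by case=> -> ->.
Qed.

Lemma coherent_refl P : coherent F P P.
Proof.
apply/coherentP => v.
suff -> : cw F v P P = false by [].
by rewrite cwE /in_lt /in_diff first_diff_refl /= !andbF.
Qed.

Lemma coherent_sym P Q : coherent F P Q = coherent F Q P.
Proof. by apply/coherentP/coherentP => cPQ v; have [-> ->] := cPQ v. Qed.

(** [cw v Z Q] only depends on the edges at which [Z] and [Q] part before and
    after [v], so that it is transported along with them. *)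
Lemma cw_transferl v w Q Z : cw F v Z Q -> visits Z w ->
  [\/ forall Z', visits Z' w -> path_to Z' w = path_to Z w -> cw F v Z' Q,
      forall Z', visits Z' w -> path_from Z' w = path_from Z w -> cw F v Z' Q
    | cw F w Z Q].
Proof.
rewrite cwE => /and4P[vZ vQ]; rewrite /in_lt /out_lt in_diff_sym.
case dI: in_diff => [[a b]|] //= rI; case dO: out_diff => [[c d]|] //= rO wZ.
have [tr|tr|[wQ dI' dO']] := diff_transfer vQ vZ wZ dI dO.
- constructor 1 => Z' wZ' /(tr _ wZ')[vZ' dI' dO'].
  by rewrite cwE vQ vZ' /in_lt /out_lt in_diff_sym dI' dO' /= rI.
- constructor 2 => Z' wZ' /(tr _ wZ')[vZ' dI' dO'].
  by rewrite cwE vQ vZ' /in_lt /out_lt in_diff_sym dI' dO' /= rI.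
- by constructor 3; rewrite cwE wQ wZ /in_lt /out_lt in_diff_sym dI' dO' /= rI.
Qed.

Lemma cw_transferr v w Q Z : cw F v Q Z -> visits Z w ->
  [\/ forall Z', visits Z' w -> path_to Z' w = path_to Z w -> cw F v Q Z',
      forall Z', visits Z' w -> path_from Z' w = path_from Z w -> cw F v Q Z'
    | cw F w Q Z].
Proof.
rewrite cwE => /and4P[vQ vZ]; rewrite /in_lt /out_lt out_diff_sym.
case dI: in_diff => [[a b]|] //= rI; case dO: out_diff => [[c d]|] //= rO wZ.
have [tr|tr|[wQ dI' dO']] := diff_transfer vQ vZ wZ dI dO.
- constructor 1 => Z' wZ' /(tr _ wZ')[vZ' dI' dO'].
  by rewrite cwE vQ vZ' /in_lt /out_lt out_diff_sym dI' dO' /= rI.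
- constructor 2 => Z' wZ' /(tr _ wZ')[vZ' dI' dO'].
  by rewrite cwE vQ vZ' /in_lt /out_lt out_diff_sym dI' dO' /= rI.
- by constructor 3; rewrite cwE wQ wZ /in_lt /out_lt out_diff_sym dI' dO' /= rI.
Qed.

Lemma in_lt_eqr w P Q Z : path_to Q w = path_to Z w ->
  in_lt F w P Q = in_lt F w P Z.
Proof. by rewrite /in_lt /in_diff => ->. Qed.

Lemma in_lt_eql w P Q Z : path_to Q w = path_to Z w ->
  in_lt F w Q P = in_lt F w Z P.
Proof. by rewrite /in_lt /in_diff => ->. Qed.

Lemma out_lt_eqr w P Q Z : path_from Q w = path_from Z w ->
  out_lt F w P Q = out_lt F w P Z.
Proof. by rewrite /out_lt /out_diff => ->. Qed.

Lemma out_lt_eql w P Q Z : path_from Q w = path_from Z w ->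
  out_lt F w Q P = out_lt F w Z P.
Proof. by rewrite /out_lt /out_diff => ->. Qed.

Lemma cw_trans w P Q Z : cw F w P Q -> cw F w Q Z -> cw F w P Z.
Proof.
rewrite !cwE => /and4P[wP wQ i1 o1] /and4P[_ wZ i2 o2].
by rewrite wP wZ (in_lt_trans wP wQ wZ i1 i2) (out_lt_trans wZ wQ wP o2 o1).
Qed.

(** When two routes are incoherent at [w], the routes obtained by switching
    from one to the other at [w] inherit coherence with any third route. *)
Section Resolvents.
Variables (w : 'I_n.+2) (A B : route G).
Hypothesis cwAB : cw F w A B.

(** If the common piece of [P] and [Z] around [v] does not contain [w], then
    [P] is incoherent with the one of [A], [B] that [Z] follows there.
    Otherwise they are incoherent at [w]: if [P] is below [Z] there, it is also
    below [B], because the piece of [Z] before [w] is at most that of [B] and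
    the piece after [w] at least that of [B]; if [P] is above [Z], it is above
    [A] in the same way. *)
Lemma resolvent_coherent P Z : visits Z w ->
  path_to Z w = path_to A w \/ path_to Z w = path_to B w ->
  path_from Z w = path_from A w \/ path_from Z w = path_from B w ->
  coherent F P A -> coherent F P B -> coherent F P Z.
Proof.
move=> wZ eZ1 eZ2 /coherentP cPA /coherentP cPB; apply/coherentP => v.
move: (cwAB); rewrite cwE => /and4P[wA wB iAB oBA].
split; apply/negP.
  case/(cw_transferr)/(_ wZ) => [tr|tr|].
  - case: eZ1 => e; [have := tr _ wA (esym e)|have := tr _ wB (esym e)].
      by rewrite (cPA v).1.
    by rewrite (cPB v).1.
  - case: eZ2 => e; [have := tr _ wA (esym e)|have := tr _ wB (esym e)].
      by rewrite (cPA v).1.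
    by rewrite (cPB v).1.
  rewrite cwE => /and4P[wP _ iPZ oZP].
  suff : cw F w P B by rewrite (cPB w).1.
  rewrite cwE wP wB /=; apply/andP; split.
    case: eZ1 => e; last by rewrite -(in_lt_eqr _ e).
    by apply: in_lt_trans wP wA wB _ iAB; rewrite -(in_lt_eqr _ e).
  case: eZ2 => e; last by rewrite -(out_lt_eql _ e).
  by apply: out_lt_trans wB wA wP oBA _; rewrite -(out_lt_eql _ e).
case/(cw_transferl)/(_ wZ) => [tr|tr|].
- case: eZ1 => e; [have := tr _ wA (esym e)|have := tr _ wB (esym e)].
    by rewrite (cPA v).2.
  by rewrite (cPB v).2.
- case: eZ2 => e; [have := tr _ wA (esym e)|have := tr _ wB (esym e)].
    by rewrite (cPA v).2.
  by rewrite (cPB v).2.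
rewrite cwE => /and4P[_ wP iZP oPZ].
suff : cw F w A P by rewrite (cPA w).2.
rewrite cwE wP wA /=; apply/andP; split.
  case: eZ1 => e; first by rewrite -(in_lt_eql _ e).
  by apply: in_lt_trans wA wB wP iAB _; rewrite -(in_lt_eql _ e).
case: eZ2 => e; first by rewrite -(out_lt_eqr _ e).
by apply: out_lt_trans wP wB wA _ oBA; rewrite -(out_lt_eqr _ e).
Qed.

End Resolvents.

Lemma clique_sub (S T : {set route G}) :
  S \subset T -> clique F T -> clique F S.
Proof.
move=> /fintype.subsetP ST /forall_inP cT.
apply/forall_inP => P /ST /cT /forall_inP cP.
by apply/forall_inP => Q /ST /cP.
Qed.

Lemma cliqueP (S : {set route G}) :
  reflect {in S &, forall P Q, coherent F P Q} (clique F S).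
Proof.
apply: (iffP forall_inP) => cS P.
  by move=> Q /cS /forall_inP cP /cP.
by move=> PS; apply/forall_inP => Q; apply: cS.
Qed.

Lemma clique_setU1 (S : {set route G}) P : clique F S ->
  {in S, forall Q, coherent F P Q} -> clique F (P |: S).
Proof.
move=> /cliqueP cS cP; apply/cliqueP => Q Q'.
rewrite !inE => /predU1P[->|QS] /predU1P[->|Q'S].
- exact: coherent_refl.
- exact: cP.
- by rewrite coherent_sym cP.
- exact: cS.
Qed.

Lemma maxclique_clique (C : maxclique F) : clique F (val C).
Proof. by have /maxsetP[] := valP C. Qed.

Lemma maxclique_max (C : maxclique F) S :
  clique F S -> val C \subset S -> S = val C.
Proof. by have /maxsetP[_] := valP C; apply. Qed.

Lemma clique_extend S : clique F S -> exists C : maxclique F, S \subset val C.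
Proof. by move=> /maxset_exists[C mC SC]; exists (exist _ C mC). Qed.

Lemma maxclique_add (C : maxclique F) P :
  {in val C, forall Q, coherent F P Q} -> P \in val C.
Proof.
move=> cP; rewrite -(maxclique_max (clique_setU1 (maxclique_clique C) cP)).
  by rewrite setU11.
exact: finset.subsetUr.
Qed.

Lemma flip_ltP (C C' : maxclique F) : reflect
  (exists R R' v, [/\ C' != C, R \in val C, R' \in val C',
     val C' = (R' |: (val C :\ R))%SET & cw F v R R'])
  (flip_lt C C').
Proof.
apply: (iffP exists_inP).
  move=> [R RC /existsP[R' /existsP[v /and3P[CC' /eqP e cwR]]]].
  by exists R, R', v; split=> //; rewrite e setU11.
move=> [R [R' [v [CC' RC R'C e cwR]]]]; exists R => //.
by apply/existsP; exists R'; apply/existsP; exists v; rewrite e eqxx cwR -e CC'.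
Qed.

(** * Flips are cover relations *)
Section Interval.
(** This is a property of triangulations: a face of codimension one is
    contained in at most two maximal simplices. *)
Hypothesis two_cliques : forall C C' D : maxclique F,
  flip_lt C C' -> val C :&: val C' \subset val D -> D = C \/ D = C'.

(** Adding [Z] to the common part of the two cliques gives a clique. It extends
    to a maximal clique, which is [C] or [C'] by hypothesis. *)
Lemma resolvent_in_both (C C' : maxclique F) R R' w Z :
  C' != C -> R \in val C -> R' \in val C' ->
  val C' = (R' |: (val C :\ R))%SET -> cw F w R R' ->
  visits Z w ->
  path_to Z w = path_to R w \/ path_to Z w = path_to R' w ->
  path_from Z w = path_from R w \/ path_from Z w = path_from R' w ->
  Z != R -> Z != R' -> Z \in val C :&: val C'.
Proof.
move=> nCC RC R'C eC' cwR wZ e1 e2 ZR ZR'.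
have flip : flip_lt C C' by apply/flip_ltP; exists R, R', w.
have /cliqueP cC := maxclique_clique C.
have /cliqueP cC' := maxclique_clique C'.
have cS : clique F (Z |: (val C :&: val C')).
  apply: clique_setU1.
    exact: clique_sub (finset.subsetIl _ _) (maxclique_clique C).
  move=> Q; rewrite inE => /andP[QC QC'].
  rewrite coherent_sym; apply: (resolvent_coherent cwR wZ e1 e2).
    exact: cC.
  exact: cC'.
have [D SD] := clique_extend cS.
have ZD : Z \in val D by rewrite (fintype.subsetP SD) // setU11.
have [|eD|eD] := two_cliques flip (D := D).
- by apply: fintype.subset_trans SD; apply: finset.subsetUr.
- by rewrite eD in ZD; rewrite inE ZD eC' !inE ZR ZD orbT.
- rewrite eD in ZD; rewrite inE ZD andbT.
  by move: ZD; rewrite eC' !inE (negPf ZR') => /andP[].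
Qed.

Definition has_above P (C : maxclique F) : bool :=
  [exists Q in val C, [exists v, cw F v P Q]].
Definition has_below P (C : maxclique F) : bool :=
  [exists Q in val C, [exists v, cw F v Q P]].

Lemma has_aboveP P (C : maxclique F) :
  reflect (exists Q v, Q \in val C /\ cw F v P Q) (has_above P C).
Proof.
apply: (iffP exists_inP) => [[Q QC /existsP[v cwv]]|[Q [v [QC cwv]]]].
  by exists Q, v.
by exists Q => //; apply/existsP; exists v.
Qed.

Lemma has_belowP P (C : maxclique F) :
  reflect (exists Q v, Q \in val C /\ cw F v Q P) (has_below P C).
Proof.
apply: (iffP exists_inP) => [[Q QC /existsP[v cwv]]|[Q [v [QC cwv]]]].
  by exists Q, v.
by exists Q => //; apply/existsP; exists v.
Qed.

Lemma mem_maxclique P (C : maxclique F) :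
  (P \in val C) = ~~ has_above P C && ~~ has_below P C.
Proof.
have /cliqueP cC := maxclique_clique C.
apply/idP/andP => [PC|[nA nB]].
  split; apply/negP; [case/has_aboveP|case/has_belowP] => Q [v [QC]].
    by have /coherentP/(_ v)[->] := cC _ _ PC QC.
  by have /coherentP/(_ v)[_ ->] := cC _ _ PC QC.
apply: maxclique_add => Q QC; apply/coherentP => v; split; apply/negP => cwv.
  by case/has_aboveP: nA; exists Q, v.
by case/has_belowP: nB; exists Q, v.
Qed.

Lemma resolvents (C C' : maxclique F) R R' w :
  C' != C -> R \in val C -> R' \in val C' ->
  val C' = (R' |: (val C :\ R))%SET -> cw F w R R' ->
  exists X Y, [/\ X \in val C :&: val C', Y \in val C :&: val C',
    visits X w, visits Y w &
   [/\ path_to X w = path_to R w, path_from X w = path_from R' w,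
      path_to Y w = path_to R' w & path_from Y w = path_from R w]].
Proof.
move=> nCC RC R'C eC' cwR; move: (cwR); rewrite cwE => /and4P[wR wR' iR oR].
have [X [wX X1 X2]] := splice wR wR'; have [Y [wY Y1 Y2]] := splice wR' wR.
have nin P : in_lt F w P P = false by rewrite /in_lt /in_diff first_diff_refl.
have nout P : out_lt F w P P = false.
  by rewrite /out_lt /out_diff first_diff_refl.
exists X, Y; split=> //;
  apply: (resolvent_in_both nCC RC R'C eC' cwR) => //; auto.
- by apply/eqP => e; move: oR; rewrite -(out_lt_eql _ X2) e nout.
- by apply/eqP => e; move: iR; rewrite -(in_lt_eql _ X1) e nin.
- by apply/eqP => e; move: iR; rewrite -(in_lt_eqr _ Y1) e nin.
- by apply/eqP => e; move: oR; rewrite -(out_lt_eqr _ Y2) e nout.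
Qed.

(** If the route above [P] is the one leaving the clique, [R], then [P] and [R]
    part around [v] before or after meeting [w], and one of the two resolvents
    follows [R] there; or [P] is below [R] at [w], hence below [R']. *)
Lemma has_above_flip P (C C' : maxclique F) :
  flip_lt C C' -> has_above P C -> has_above P C'.
Proof.
move=> /flip_ltP[R [R' [w [nCC RC R'C eC' cwR]]]].
have [X [Y [XS YS wX wY [X1 X2 Y1 Y2]]]] := resolvents nCC RC R'C eC' cwR.
move/finset.setIP: XS => [_ XC']; move/finset.setIP: YS => [_ YC'].
move/has_aboveP=> [Q [v [QC cwv]]]; apply/has_aboveP.
case: (eqVneq Q R) => [eQ|QR]; last by exists Q, v; rewrite eC' !inE QR QC orbT.
rewrite {Q QC}eQ in cwv; move: (cwR); rewrite cwE => /andP[wR _].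
have [tr|tr|cww] := cw_transferr cwv wR.
- by exists X, v; rewrite tr.
- by exists Y, v; rewrite tr.
- by exists R', w; rewrite (cw_trans cww cwR).
Qed.

Lemma has_below_flip P (C C' : maxclique F) :
  flip_lt C C' -> has_below P C' -> has_below P C.
Proof.
move=> /flip_ltP[R [R' [w [nCC RC R'C eC' cwR]]]].
have [X [Y [XS YS wX wY [X1 X2 Y1 Y2]]]] := resolvents nCC RC R'C eC' cwR.
move/finset.setIP: XS => [XC _]; move/finset.setIP: YS => [YC _].
move/has_belowP=> [Q [v [QC cwv]]]; apply/has_belowP.
move: QC; rewrite eC' !inE => /predU1P[eQ|/andP[_ QC]]; last by exists Q, v.
rewrite {Q}eQ in cwv; move: (cwR); rewrite cwE => /and3P[_ wR' _].
have [tr|tr|cww] := cw_transferl cwv wR'.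
- by exists Y, v; rewrite tr.
- by exists X, v; rewrite tr.
- by exists R, w; rewrite (cw_trans cwR cww).
Qed.

Lemma framing_le_homo (p : pred (maxclique F)) (C C' : maxclique F) :
  (forall D D', flip_lt D D' -> p D -> p D') -> framing_le C C' -> p C -> p C'.
Proof.
move=> hp /connectP[s ps ->] {C'}.
elim: s C ps => //= D s IHs C /andP[CD ps] pC.
exact: IHs ps (hp _ _ CD pC).
Qed.

(** A route missing in [D] has a route of [D] above it, hence also one of [C'],
    or one below it, hence also one of [C]. *)
Lemma interval_mem (C D C' : maxclique F) :
  framing_le C D -> framing_le D C' -> val C :&: val C' \subset val D.
Proof.
move=> CD DC'; apply/fintype.subsetP => P /finset.setIP[].
rewrite !mem_maxclique => /andP[_ nB] /andP[nA _]; apply/andP; split.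
  by apply: contra nA; apply: framing_le_homo DC' => ? ?; apply: has_above_flip.
apply: contraTN (nB) => hB; apply/negP => nB'; move: hB; apply/negP.
apply: (framing_le_homo (p := fun D => ~~ has_below P D)) CD nB => E E' EE'.
exact/contra/has_below_flip.
Qed.

Lemma flip_lt_cover (C C' : maxclique F) : flip_lt C C' -> framing_cover C C'.
Proof.
move=> flip; apply/andP; split.
  rewrite /framing_lt /framing_le connect1 // andbT.
  by case/flip_ltP: flip => [? [? [? [+ _ _ _ _]]]]; rewrite eq_sym.
apply/forallP => D; apply/negP => /andP[/andP[nCD CD] /andP[nDC' DC']].
by case: (two_cliques flip (interval_mem CD DC')) => eD;
  rewrite eD eqxx in nCD nDC'.
Qed.

Lemma cover_flip_lt (C C' : maxclique F) : framing_cover C C' -> flip_lt C C'.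
Proof.
case/andP=> /andP[nCC' /connectP[[|D s] /= ps eC']] /forallP noD.
  by rewrite eC' eqxx in nCC'.
case/andP: ps => CD ps; suff -> : C' = D by [].
apply/eqP; rewrite eq_sym; apply: contraNT (noD D) => nDC'.
rewrite /framing_lt nDC' /framing_le connect1 // andbT /=.
have -> /= : connect (@flip_lt n G F) D C' by apply/connectP; exists s.
by rewrite andbT eq_sym; case/flip_ltP: CD => [? [? [? []]]].
Qed.

End Interval.

End Coherence.

Local Open Scope ring_scope.
Local Open Scope classical_set_scope.

(** * Admissible heights and cliques *)
Section Hulls.
Variables (R : realType) (n : nat) (G : flowGraph n).
Implicit Types (P Q : route G) (S T : {set route G}).

(** The indicator of [P] is a convex combination of those of the routes of [S];
    a route with positive weight in it uses edges of [P] only, so it is [P]. *)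
Lemma route_hull_vertex S P : route_hull S (indicator R P) -> P \in S.
Proof.
case=> w [w_ge0 w_out w_sum wP]; apply/negPn/negP => PS.
suff w0 Q : w Q = 0.
  by move: w_sum; rewrite big1 => [/esym/eqP|//]; rewrite oner_eq0.
apply/eqP; case: (boolP (Q \in S)) => [QS|/w_out/eqP //].
(* Some Q in S has a positive weight; every edge of Q is one of P. *)
apply: contraNT PS => wQ0; suff -> : P = Q by [].
apply/edges_of_inj/esym.
apply: walk_subset (edges_of_walk P) (edges_of_walk Q) _.
move=> e eQ; apply: contraNT wQ0 => eP; move/eqP: (wP e).
rewrite ffunE (negPf eP) eq_sym psumr_eq0; last first.
  by move=> Q' _; rewrite mulr_ge0 // ffunE ler0n.
by move=> /allP/(_ Q (mem_index_enum _)); rewrite ffunE eQ mulr1.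
Qed.

Lemma mem_route_hull S P : P \in S -> route_hull S (indicator R P).
Proof.
move=> PS; exists (fun Q => (Q == P)%:R); split.
- by move=> Q; rewrite ler0n.
- by move=> Q; case: eqVneq => [->|//]; rewrite PS.
- by rewrite (bigD1 P) //= eqxx big1 ?addr0 // => Q /negPf ->.
- move=> e; rewrite (bigD1 P) //= eqxx mul1r big1 ?addr0 // => Q /negPf ->.
  by rewrite mul0r.
Qed.

Lemma route_hull_inj S T : route_hull (R := R) S = route_hull T -> S = T.
Proof.
move=> eST; apply/finset.setP => P; apply/idP/idP => /mem_route_hull.
  by rewrite eST => /route_hull_vertex.
by rewrite -eST => /route_hull_vertex.
Qed.

Variables (F : framing G) (h : route G -> R).
Hypothesis hadm : admissible F h.

Lemma clique_minimizers (y : {ffun edge G -> R}) : clique F (minimizers h y).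
Proof.
have : framed_triangulation F (route_hull (R := R) (minimizers h y)).
  by rewrite -hadm; exists y.
by case=> S [_ cS /route_hull_inj ->].
Qed.

Lemma minimizers_clique S : S != finset.set0 -> clique F S ->
  exists y, minimizers h y = S.
Proof.
move=> S0 cS; have : regular_subdivision h (route_hull S).
  by rewrite hadm; exists S.
by case=> y _ /route_hull_inj <-; exists y.
Qed.

End Hulls.

(** * Edges labelled 0 *)
Section Walks.
Variables (n : nat) (G : flowGraph n) (F : framing G).
Implicit Types (e : edge G) (u v : 'I_n.+2).

Lemma walk_from_source v : exists p : seq (edge G), walk ord0 p v.
Proof.
have [k] := ubnP (v : nat); elim: k v => // k IHk v; rewrite ltnS => vk.
case: (eqVneq v ord0) => [->|v0]; first by exists [::]; rewrite /= eqxx.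
have [e eh] := unique_source G v0.
have [|p wp] := IHk (tail e).
  by apply: leq_trans vk; rewrite -eh tail_lt_head.
by exists (rcons p e); rewrite -cats1; apply/walk_catP; exists (tail e);
  rewrite //= eqxx eh eqxx.
Qed.

(** The edge with the least label is the largest one in the framing order: any
    edge above it would have a smaller label. *)
Lemma top_edge_exists v : v != ord_max ->
  exists e, tail e = v /\ out_label F e = 0%N.
Proof.
move=> /(unique_sink G)[e0 te0].
have e0v : e0 \in [pred e | tail e == v] by rewrite inE te0.
case: (arg_minnP (out_label F) e0v) => e /= /eqP te emin.
exists e; split=> //; apply/eqP; rewrite cards_eq0 -finset.subset0.
apply/fintype.subsetP => e'; rewrite !inE => /and3P[/eqP te' nee' lee'].
suff : (out_label F e' < out_label F e)%N.
  by rewrite ltnNge emin //= te' te.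
apply: proper_card; apply/fintype.properP; split; last first.
  by exists e'; rewrite !inE ?eqxx ?andbF // te' eqxx nee'.
apply/fintype.subsetP => a; rewrite !inE te' => /and3P[/eqP ta nae' le'a].
rewrite ta eqxx /=; have lea : frout F (tail e) e a.
  by apply: frout_trans lee' _; rewrite ?te' ?ta.
rewrite lea andbT; apply: contraNneq nae' => ae.
rewrite ae in le'a *; rewrite (frout_anti _ lee' le'a) //.
Qed.

Lemma top_edge_uniq e e' : tail e = tail e' ->
  out_label F e = 0%N -> out_label F e' = 0%N -> e = e'.
Proof.
have [_ _ tot] := frout_linear F (tail e) => te.
move=> /eqP; rewrite cards_eq0 => /eqP/finset.setP/(_ e').
move=> + /eqP; rewrite cards_eq0 => + /eqP/finset.setP/(_ e).
rewrite !inE -te eqxx /= [e == e']eq_sym; case: eqVneq => //= _ lee' le'e.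
have := tot e e'; rewrite !inE -te eqxx lee' le'e.
by move=> /(_ isT isT).
Qed.

Lemma top_walk_exists v : exists p : seq (edge G),
  walk v p ord_max && all (fun e => out_label F e == 0%N) p.
Proof.
have [k] := ubnP (n.+1 - v)%N; elim: k v => // k IHk v; rewrite ltnS => vk.
case: (eqVneq v ord_max) => [->|vm]; first by exists [::]; rewrite /= eqxx.
have [e [te le0]] := top_edge_exists vm.
have [|p /andP[wp ap]] := IHk (head e).
  apply: leq_trans vk; rewrite -te ltn_sub2l ?tail_lt_head //.
  by apply: leq_trans (tail_lt_head e) _; rewrite -ltnS ltn_ord.
by exists (e :: p); rewrite /= te eqxx wp le0 eqxx ap.
Qed.

Lemma top_walk_uniq v (p q : seq (edge G)) :
  walk v p ord_max -> all (fun e => out_label F e == 0%N) p ->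
  walk v q ord_max -> all (fun e => out_label F e == 0%N) q -> p = q.
Proof.
elim: p v q => [|a p IHp] v q; first by move=> /= /eqP -> _ /walk_nil ->.
case: q => [|b q] wp ap wq aq; first by case/eqP: wq wp => -> /walk_nil.
case/andP: wp wq => /eqP ta wp /andP[/eqP tb wq].
case/andP: ap aq => /eqP la ap /andP[/eqP lb aq].
have ab : a = b by apply: top_edge_uniq => //; rewrite ta tb.
by subst b; rewrite (IHp _ _ wp ap wq aq).
Qed.

Lemma route_cons (P : route G) : exists a q,
  [/\ edges_of P = a :: q, tail a = ord0 & {in q, forall e, tail e != ord0}].
Proof.
have := edges_of_walk P; case: (edges_of P) => [|a q] //= /andP[/eqP ta wq].
exists a, q; split=> // e eq; apply: contraTneq (walk_tail wq eq) => ->.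
by rewrite -ltnNge; apply: leq_ltn_trans (tail_lt_head a).
Qed.

End Walks.

(** * Tropical points as linear functionals *)
Section Weights.
Variables (R : realType) (n : nat) (G : flowGraph n) (F : framing G).
Variable h : route G -> R.
Notation point := (trop_point R F).
Implicit Types (P Q : route G) (S T : {set route G}) (x y d : point).

(** Routes are grouped by their first edge instead of being cut into a source
    edge and a route of the remaining graph; this keeps
    all routes in one type. *)
Definition same_source P Q := ohead (edges_of P) == ohead (edges_of Q).

Lemma same_source_refl P : same_source P P. Proof. exact: eqxx. Qed.

Lemma same_source_sym P Q : same_source P Q = same_source Q P.
Proof. exact: eq_sym. Qed.

Lemma same_source_trans Q P P' :
  same_source P Q -> same_source Q P' -> same_source P P'.
Proof. by rewrite /same_source => /eqP ->. Qed.

Definition pairing P x : R :=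
  \sum_(i : trop_index F) (val i \in edges_of P)%:R * x i.

Definition weight x P : R := - h P + pairing P x.

Definition argmin x : {set route G} :=
  [set P | [forall Q, same_source P Q ==> (weight x P <= weight x Q)]]%SET.

Definition source_full S : bool :=
  [forall P, [exists Q in S, same_source P Q]].

Lemma argminP x P :
  reflect (forall Q, same_source P Q -> weight x P <= weight x Q)
          (P \in argmin x).
Proof. by rewrite inE; apply: (iffP forallP) => H Q; exact/implyP/H. Qed.

Lemma source_fullP S :
  reflect (forall P, exists2 Q, Q \in S & same_source P Q) (source_full S).
Proof.
by apply: (iffP forallP) => H P; exact/exists_inP/H.
Qed.

Lemma source_fullS S T : S \subset T -> source_full S -> source_full T.
Proof.
move=> /fintype.subsetP ST /source_fullP fS; apply/source_fullP => P.
by have [Q /ST] := fS P; exists Q.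
Qed.

Lemma argmin_full x : source_full (argmin x).
Proof.
apply/source_fullP => P.
case: (arg_minP (weight x) (same_source_refl P)) => Q PQ Qmin.
exists Q => //; apply/argminP => Q' QQ'; apply: Qmin.
exact: same_source_trans PQ QQ'.
Qed.

Lemma argmin_eq x P Q : P \in argmin x -> Q \in argmin x -> same_source P Q ->
  weight x P = weight x Q.
Proof.
move=> /argminP mP /argminP mQ PQ; apply/le_anti.
by rewrite mP // mQ // same_source_sym.
Qed.

Lemma argmin_weight x P Q : P \in argmin x -> same_source P Q ->
  weight x Q = weight x P -> Q \in argmin x.
Proof.
move=> /argminP mP PQ e; apply/argminP => Q' QQ'; rewrite e; apply: mP.
exact: same_source_trans QQ'.
Qed.

Lemma pairingD P x y : pairing P (x + y) = pairing P x + pairing P y.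
Proof.
by rewrite /pairing -big_split; apply: eq_bigr => i _; rewrite ffunE mulrDr.
Qed.

Lemma pairingZ P t x : pairing P (t *: x) = t * pairing P x.
Proof.
rewrite /pairing big_distrr; apply: eq_bigr => i _.
by rewrite ffunE /= mulrCA.
Qed.

Lemma pairingB P x y : pairing P (x - y) = pairing P x - pairing P y.
Proof. by rewrite -scaleN1r pairingD pairingZ mulN1r. Qed.

Lemma weight_line x d t P :
  weight (x + t *: d) P = weight x P + t * pairing P d.
Proof. by rewrite /weight pairingD pairingZ addrA. Qed.

Lemma pairing_sub x y P : pairing P (y - x) = weight y P - weight x P.
Proof. by rewrite pairingB /weight; ring. Qed.

(** A tropical point as a weight on all edges: the coordinates that are
    normalized away are 0. *)
Definition extend x (e : edge G) : R :=
  if insub e is Some i then x (i : trop_index F) else 0.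

Lemma extend_val x (i : trop_index F) : extend x (val i) = x i.
Proof. by rewrite /extend valK. Qed.

Lemma extend0 x e : ~~ ((tail e != ord0) && (0 < out_label F e)%N) ->
  extend x e = 0.
Proof. by move=> ne; rewrite /extend insubN. Qed.

Lemma pairingE P x : pairing P x = \sum_(e <- edges_of P) extend x e.
Proof.
rewrite big_uniq ?edges_of_uniq //=.
rewrite (bigID (fun e => (tail e != ord0) && (0 < out_label F e)%N)) /=.
rewrite [X in _ + X]big1 ?addr0; last by move=> e /andP[_ /extend0 ->].
rewrite (reindex_omap (val : trop_index F -> _) insub) /=; last first.
  by move=> e /andP[_ ne]; rewrite insubT.
rewrite /pairing [RHS]big_mkcond; apply: eq_bigr => i _.
rewrite (valP i) andbT valK eqxx andbT extend_val.
by case: ifP; rewrite ?mul1r ?mul0r.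
Qed.

Lemma lifted_valueE (y : {ffun edge G -> R}) P :
  lifted_value h y P = - h P + \sum_(e <- edges_of P) y e.
Proof.
rewrite /lifted_value; congr (_ + _).
rewrite [RHS]big_uniq ?edges_of_uniq //= [RHS]big_mkcond /=.
apply: eq_bigr => e _; rewrite ffunE.
by case: ifP; rewrite ?mul1r ?mul0r.
Qed.

Lemma sum_potential (phi : 'I_n.+2 -> R) u p v : walk u p v ->
  \sum_(e <- p) (phi (head (e : edge G)) - phi (tail e)) = phi v - phi u.
Proof.
elim: p u => [|e p IHp] u /=; first by move=> /eqP ->; rewrite big_nil subrr.
by move=> /andP[/eqP <- /IHp]; rewrite big_cons => ->; ring.
Qed.

(** The potential of a vertex is the weight of the path of edges labelled 0
    from it to the sink. Subtracting it makes these edges weightless and, as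
    differences of potentials telescope, shifts the weight of a route by an
    amount that only depends on its first edge. *)
Lemma gauge (y : {ffun edge G -> R}) : exists x (c : edge G -> R),
  forall P a, ohead (edges_of P) = Some a ->
    lifted_value h y P = weight x P + c a.
Proof.
have [z zP] := choice (top_walk_exists F).
pose phi v := \sum_(e <- z v) y e.
have phi_max : phi ord_max = 0.
  rewrite /phi; have /andP[/walk_nil -> _] := zP ord_max.
  by rewrite big_nil.
have phi_top e : out_label F e = 0%N -> phi (tail e) = y e + phi (head e).
  move=> le0; rewrite /phi; have /andP[w1 a1] := zP (tail e).
  have /andP[w2 a2] := zP (head e).
  rewrite (top_walk_uniq (q := e :: z (head e)) w1 a1) ?big_cons //=.
    by rewrite eqxx.
  by rewrite le0.
pose x : point :=
  [ffun i => y (val i) + (phi (head (val i)) - phi (tail (val i)))].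
have xE e : tail e != ord0 ->
    extend x e = y e + (phi (head e) - phi (tail e)).
  move=> te; case: (posnP (out_label F e)) => le.
    by rewrite (phi_top _ le) extend0 ?le ?andbF //; ring.
  have ie : (tail e != ord0) && (0 < out_label F e)%N by rewrite te le.
  by rewrite -[e]/(val (Sub e ie : trop_index F)) extend_val ffunE.
exists x, (fun a => y a + phi (head a)) => P a.
have [b [q [eP tb tq]]] := route_cons P; rewrite eP => -[ba]; subst b.
rewrite lifted_valueE /weight pairingE eP !big_cons.
rewrite (_ : extend x a = 0); last by rewrite extend0 // tb eqxx.
rewrite add0r.
have -> : \sum_(e <- q) extend x e =
    \sum_(e <- q) (y e + (phi (head e) - phi (tail e))).
  by apply: eq_big_seq => e /tq; apply: xE.
have wq : walk (head a) q ord_max.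
  by have := edges_of_walk P; rewrite eP => /andP[].
by rewrite big_split /= (sum_potential _ wq) phi_max; ring.
Qed.

Lemma ungauge x (c : edge G -> R) : exists y : {ffun edge G -> R},
  forall P a, ohead (edges_of P) = Some a ->
    lifted_value h y P = weight x P + c a.
Proof.
exists [ffun e => if tail e == ord0 then c e else extend x e] => P a.
have [b [q [eP tb tq]]] := route_cons P; rewrite eP => -[ba]; subst b.
rewrite lifted_valueE /weight pairingE eP !big_cons ffunE tb eqxx.
rewrite (_ : extend x a = 0); last by rewrite extend0 // tb eqxx.
rewrite add0r -addrA [_ + c a]addrC.
congr (_ + (_ + _)); apply: eq_big_seq => e /tq te.
by rewrite ffunE (negPf te).
Qed.

(** The free weight of each source edge is chosen to bring the minimum over the
    routes starting with it to 0. *)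
Lemma argmin_minimizers x : exists y : {ffun edge G -> R},
  minimizers h y = argmin x.
Proof.
pose c a := if [pick Q in argmin x | ohead (edges_of Q) == Some a] is Some Q
  then - weight x Q else 0.
have [y yP] := ungauge x c; exists y.
have val_ge P : 0 <= lifted_value h y P /\
    (P \in argmin x -> lifted_value h y P = 0) /\
    (lifted_value h y P = 0 -> P \in argmin x).
  have [a [q [eP _ _]]] := route_cons P.
  have oP : ohead (edges_of P) = Some a by rewrite eP.
  rewrite (yP _ _ oP) /c; case: pickP => [Q /andP[Qm /eqP oQ]|no]; last first.
    have /source_fullP/(_ P)[Q Qm /eqP oQ] := argmin_full x.
    by have := no Q; rewrite /= Qm -oQ oP eqxx.
  have QP : same_source Q P by rewrite /same_source oP oQ.
  split; first by rewrite subr_ge0; move/argminP: Qm => /(_ _ QP).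
  split=> [Pm|/eqP].
    by rewrite (argmin_eq Pm Qm) ?subrr // same_source_sym.
  by rewrite subr_eq0 => /eqP; apply: argmin_weight.
apply/finset.setP => P; rewrite [in LHS]inE; apply/forallP/idP => [Pmin|Pm Q].
  have /source_fullP/(_ P)[Q Qm _] := argmin_full x.
  have [_ [/(_ Qm) Q0 _]] := val_ge Q; have [P0 [_]] := val_ge P; apply.
  by apply/le_anti; rewrite P0 -Q0 Pmin.
by have [_ [/(_ Pm) -> _]] := val_ge P; have [] := val_ge Q.
Qed.

Section Admissible.
Hypothesis hadm : admissible F h.

Lemma clique_argmin x : clique F (argmin x).
Proof. by have [y <-] := argmin_minimizers x; apply: clique_minimizers. Qed.

Lemma route_exists : inhabited (route G).
Proof.
have [p wp] := walk_from_source G ord_max.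
by have [P _] := walk_route wp; constructor.
Qed.

(** A functional minimized exactly on [S] is normalized to a point. When [S]
    has a route with every source, the minimum over all routes is also the
    minimum over each group of routes with a common source. *)
Lemma clique_point S : S != finset.set0 -> clique F S ->
  exists2 x, S \subset argmin x & source_full S -> argmin x = S.
Proof.
move=> S0 cS; have [y yS] := minimizers_clique hadm S0 cS.
have [x [c xc]] := gauge y.
have cmp P Q : same_source P Q ->
    (lifted_value h y P <= lifted_value h y Q) = (weight x P <= weight x Q).
  have [a [q [eP _ _]]] := route_cons P.
  have oP : ohead (edges_of P) = Some a by rewrite eP.
  rewrite /same_source oP => /eqP/esym oQ.
  by rewrite (xc _ _ oP) (xc _ _ oQ) lerD2r.
have sub : S \subset argmin x.
  apply/fintype.subsetP => P; rewrite -yS inE => /forallP Pm.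
  by apply/argminP => Q /cmp <-.
exists x => // /source_fullP fS; apply/eqP.
rewrite finset.eqEsubset sub andbT; apply/fintype.subsetP => P /argminP Pm.
have [Q QS PQ] := fS P; rewrite -yS inE; apply/forallP => Q'.
move: QS; rewrite -yS inE => /forallP/(_ Q'); apply: le_trans.
by rewrite cmp // Pm.
Qed.

Lemma source_full_neq0 S : source_full S -> S != finset.set0.
Proof.
have [P] := route_exists => /source_fullP/(_ P)[Q QS _].
by apply/set0Pn; exists Q.
Qed.

Lemma maxclique_neq0 (C : maxclique F) : val C != finset.set0.
Proof.
have [P] := route_exists; apply/eqP => C0.
suff : P \in val C by rewrite C0 inE.
by apply: maxclique_add => Q; rewrite C0 inE.
Qed.

Lemma maxclique_point (C : maxclique F) : exists x, argmin x = val C.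
Proof.
have [x sub _] := clique_point (maxclique_neq0 C) (maxclique_clique C).
by exists x; apply: maxclique_max => //; apply: clique_argmin.
Qed.

Lemma maxclique_full (C : maxclique F) : source_full (val C).
Proof. by have [x <-] := maxclique_point C; apply: argmin_full. Qed.

Lemma sub_argmin (C : maxclique F) x :
  val C \subset argmin x -> argmin x = val C.
Proof. by apply: maxclique_max; apply: clique_argmin. Qed.

(** Compare two routes that share a path from the source to the tail of the
    edge [e]; one continues with [e], and both finish along edges labelled 0.
    Their weights differ by the coordinate of [d] at [e]. *)
Lemma pairing_eq0 d :
  (forall P Q, same_source P Q -> pairing P d = pairing Q d) -> d = 0.
Proof.
move=> same; apply/ffunP => i; rewrite ffunE -extend_val.
have /andP[te _] := valP i; set e := val i in te *.
have [p wp] := walk_from_source G (tail e).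
have [z /andP[wz az]] := top_walk_exists F (tail e).
have [z' /andP[wz' az']] := top_walk_exists F (head e).
have [P eP] : exists P : route G, edges_of P = p ++ e :: z'.
  by apply: walk_route; apply/walk_catP; exists (tail e) => //=; rewrite eqxx.
have [Q eQ] : exists P : route G, edges_of P = p ++ z.
  by apply: walk_route; apply/walk_catP; exists (tail e).
have ext0 q : all (fun e => out_label F e == 0%N) q ->
    \sum_(e <- q) extend d e = 0.
  move=> /allP aq; apply: big1_seq => a /andP[_ /aq /eqP la].
  by rewrite extend0 // la andbF.
have PQ : same_source P Q.
  rewrite /same_source eP eQ.
  by case: (p) wp te => [/eqP <-|a q _ _]; rewrite eqxx.
have := same P Q PQ; rewrite !pairingE eP eQ !big_cat big_cons /=.
rewrite (ext0 _ az) (ext0 _ az') !addr0.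
by move/eqP; rewrite -[X in _ == X]addr0 (inj_eq (addrI _)) => /eqP.
Qed.

(** The gap between a route and the members of [C] with the same source is
    positive at [x] outside [C] and varies linearly along [d]. If some gap
    decreases, let [t] be the first time at which one vanishes. At [x + t *: d]
    all of [C] is still minimal, and so is a new route, which contradicts
    maximality. *)
Lemma slope_ge (C : maxclique F) x d :
  argmin x = val C ->
  {in val C &, forall P Q, same_source P Q -> pairing P d = pairing Q d} ->
  forall P Q, Q \in val C -> same_source P Q -> pairing Q d <= pairing P d.
Proof.
move=> xC dC; have /source_fullP full := maxclique_full C.
have exrep P : exists Q, Q \in val C /\ same_source P Q.
  by have [Q QC PQ] := full P; exists Q.
have [rep repP] := choice exrep.
pose gap P := weight x P - weight x (rep P).
pose slope P := pairing P d - pairing (rep P) d.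
have gap_ge0 P : 0 <= gap P.
  have [rC rP] := repP P; rewrite subr_ge0.
  move: rC; rewrite -xC => /argminP; apply.
  by rewrite same_source_sym.
have no_bad P : 0 <= slope P.
  rewrite leNgt; apply/negP => badP.
  (* the time at which the gap of Q vanishes, if it decreases *)
  pose ratio Q := gap Q / - slope Q.
  case: (arg_minP ratio (badP : [pred Q | slope Q < 0] P)) => B /= badB Bmin.
  pose t := ratio B; have t_ge0 : 0 <= t by rewrite divr_ge0 // oppr_ge0 ltW.
  have later Q : 0 <= gap Q + t * slope Q.
    have [sQ|sQ] := leP 0 (slope Q); first by rewrite addr_ge0 // mulr_ge0.
    have := Bmin Q sQ; rewrite /ratio -/t ler_pdivlMr ?oppr_gt0 // mulrN.
    by rewrite -subr_ge0 opprK.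
  have relE Q Q' : Q' \in val C -> same_source Q Q' ->
      weight (x + t *: d) Q - weight (x + t *: d) Q' = gap Q + t * slope Q.
    move=> Q'C QQ'; have [rC rQ] := repP Q.
    have sr : same_source (rep Q) Q'.
      by apply: same_source_trans QQ'; rewrite same_source_sym.
    rewrite !weight_line /gap /slope (dC _ _ rC Q'C sr).
    rewrite (argmin_eq (x := x) (P := rep Q) (Q := Q')) ?xC //; ring.
  have CB : argmin (x + t *: d) = val C.
    apply: sub_argmin; apply/fintype.subsetP => Q QC; apply/argminP => Q'.
    rewrite same_source_sym => Q'Q; rewrite -subr_ge0 (relE _ _ QC Q'Q).
    exact: later.
  have [rC rB] := repP B; have BC : B \in val C.
    rewrite -CB; apply: (argmin_weight (P := rep B)); rewrite ?CB //.
      by rewrite same_source_sym.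
    apply/eqP; rewrite -subr_eq0 relE // /t /ratio invrN mulrN mulNr.
    by rewrite divfK ?subrr // lt_eqF.
  by move: badB; rewrite /slope (dC _ _ BC rC rB) subrr ltxx.
move=> P Q QC PQ; have [rC rP] := repP P.
have Qr : same_source Q (rep P).
  by apply: same_source_trans rP; rewrite same_source_sym.
by rewrite (dC _ _ QC rC Qr) -subr_ge0; apply: no_bad.
Qed.

(** The tropical form of the fact that the simplex of a maximal clique has full
    dimension: ties among its routes leave no direction to move in. *)
Lemma maxclique_rigid (C : maxclique F) d :
  {in val C &, forall P Q, same_source P Q -> pairing P d = pairing Q d} ->
  d = 0.
Proof.
move=> dC; have [x xC] := maxclique_point C.
have dC' : {in val C &, forall P Q, same_source P Q ->
    pairing P (- d) = pairing Q (- d)}.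
  by move=> P Q PC QC PQ; rewrite -scaleN1r !pairingZ (dC P Q).
have eqC P Q : Q \in val C -> same_source P Q -> pairing P d = pairing Q d.
  move=> QC PQ; apply/le_anti; rewrite (slope_ge xC dC QC PQ) andbT.
  have := slope_ge xC dC' QC PQ; rewrite -scaleN1r !pairingZ !mulN1r.
  by rewrite lerN2.
apply: pairing_eq0 => P Q PQ.
have /source_fullP/(_ Q)[Q' Q'C QQ'] := maxclique_full C.
by rewrite (eqC _ _ Q'C QQ') (eqC P Q') //; apply: same_source_trans QQ'.
Qed.

Lemma point_uniq (C : maxclique F) x y :
  val C \subset argmin x -> val C \subset argmin y -> x = y.
Proof.
move=> /fintype.subsetP Cx /fintype.subsetP Cy; apply/eqP; rewrite -subr_eq0.
apply/eqP; apply: (maxclique_rigid (C := C)) => P Q PC QC PQ.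
rewrite !pairing_sub (argmin_eq (Cx _ PC) (Cx _ QC) PQ).
by rewrite (argmin_eq (Cy _ PC) (Cy _ QC) PQ).
Qed.

Lemma point_inj (C C' : maxclique F) x :
  argmin x = val C -> argmin x = val C' -> C = C'.
Proof. by move=> e e'; apply: val_inj; rewrite -e -e'. Qed.

End Admissible.

End Weights.

(** * Exchanges and one-dimensional cells *)
Section Exchange.
Variables (R : realType) (n : nat) (G : flowGraph n) (F : framing G).
Variable h : route G -> R.
Hypothesis hadm : admissible F h.
Notation point := (trop_point R F).
Implicit Types (P Q A B : route G) (S T : {set route G}) (x y d : point).
Implicit Types (C D : maxclique F).

Definition cell S : set point := [set x | S \subset argmin h x].

(** A flip without its orientation, stated symmetrically in the two cliques. *)
Definition exchange C C' P P' : Prop :=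
  [/\ C != C', P \in val C, P' \in val C',
      {in val C, forall Q, Q != P -> Q \in val C'}
    & {in val C', forall Q, Q != P' -> Q \in val C}].

Lemma exchange_sym C C' P P' : exchange C C' P P' -> exchange C' C P' P.
Proof. by case=> nCC PC P'C' k k'; split; rewrite // eq_sym. Qed.

Lemma maxclique_subset C C' : val C \subset val C' -> C = C'.
Proof.
move=> CC'; apply/val_inj/esym.
by apply: maxclique_max => //; apply: maxclique_clique.
Qed.

Lemma exchange_notin C C' P P' : exchange C C' P P' -> P \notin val C'.
Proof.
case=> nCC PC _ keep _; apply: contra nCC => PC'.
apply/eqP/maxclique_subset/fintype.subsetP => Q QC.
by case: (eqVneq Q P) => [->|/keep ->].
Qed.

Lemma flip_exchange C C' : flip_lt C C' -> exists P P', exchange C C' P P'.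
Proof.
move=> /flip_ltP[P [P' [v [nCC PC P'C' eC' _]]]]; exists P, P'.
split=> //; first by rewrite eq_sym.
  by move=> Q QC QP; rewrite eC' !inE QP QC orbT.
by move=> Q; rewrite eC' !inE => /predU1P[->|/andP[_ //]]; rewrite eqxx.
Qed.

Lemma exchange_eq C C' P P' : exchange C C' P P' ->
  val C' = (P' |: (val C :\ P))%SET.
Proof.
move=> ex; have PC' := exchange_notin ex; case: ex => nCC PC P'C' k k'.
apply/finset.setP => Q; rewrite !inE; case: eqVneq => [->|QP'] //=.
apply/idP/andP => [QC'|[QP QC]]; last exact: k.
by split; [apply: contraNneq PC' => <-|apply: k'].
Qed.

(** The two exchanged routes are incoherent, since otherwise [P'] could be
    added to [C]. *)
Lemma exchange_flip C C' P P' : exchange C C' P P' ->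
  flip_lt C C' \/ flip_lt C' C.
Proof.
move=> ex; have eC' := exchange_eq ex; have eC := exchange_eq (exchange_sym ex).
have P'C := exchange_notin (exchange_sym ex).
case: ex => nCC PC P'C' k k'; have nCC' : C' != C by rewrite eq_sym.
have : ~~ coherent F P P'.
  apply: contra P'C => cPP'; apply: maxclique_add => Q QC.
  case: (eqVneq Q P) => [->|/k QC']; first by rewrite coherent_sym.
  by have /cliqueP cC' := maxclique_clique C'; apply: cC' => //; apply: QC'.
case/forallPn => v; rewrite negbK incoherent_cw => /orP[cwv|cwv].
  by left; apply/flip_ltP; exists P, P', v.
by right; apply/flip_ltP; exists P', P, v.
Qed.

Lemma exchange_mem C C' P P' Q : exchange C C' P P' -> Q \in val C ->
  Q = P \/ Q \in val C :&: val C'.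
Proof.
case=> _ _ _ k _ QC; case: (eqVneq Q P) => [->|QP]; first by left.
by right; rewrite inE QC k.
Qed.

(** If the common part had no route with some source, then [P] would be the
    only route of [C] with that source, so all pairs of routes of [C] with a
    common source would lie in [C'] too. By rigidity the points of [C] and [C']
    would coincide. *)
Lemma exchange_full C C' P P' : exchange C C' P P' ->
  source_full (val C :&: val C').
Proof.
move=> ex; have [nCC PC _ k _] := ex.
have /source_fullP fC := maxclique_full hadm C.
have [x xC] := maxclique_point hadm C; have [x' xC'] := maxclique_point hadm C'.
apply/source_fullP => Q; have [A AC QA] := fC Q.
case: (exchange_mem ex AC) => [eA|AS]; last by exists A.
suff [B BS PB] : exists2 B, B \in val C :&: val C' & same_source P B.
  by exists B => //; apply: same_source_trans PB; rewrite -eA.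
apply: contrapT => noB; move/eqP: nCC; apply; apply: (point_inj (x := x) xC).
rewrite (_ : x = x') //; apply/esym/eqP; rewrite -subr_eq0; apply/eqP.
apply: (maxclique_rigid hadm (C := C)) => B B' BC B'C BB'.
case: (exchange_mem ex BC) (exchange_mem ex B'C) => [eB|BS] [eB'|B'S].
- by rewrite eB eB'.
- by case: noB; exists B' => //; rewrite -eB.
- by case: noB; exists B => //; rewrite -eB' same_source_sym.
move: BS B'S; rewrite !inE -xC -xC' => /andP[B1 B2] /andP[B3 B4].
rewrite !(pairing_sub h) (argmin_eq B1 B3 BB') (argmin_eq B2 B4 BB') //.
Qed.

(** The points keeping the routes of the common part tied form a line by
    rigidity, as the gap between [P] and a route [P0] of the common part with
    the same source is the only remaining freedom. It serves as a coordinate on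
    that line, and it is nonnegative on the cell. *)
Lemma exchange_line C C' P P' x x' y : exchange C C' P P' ->
  argmin h x = val C -> argmin h x' = val C' -> cell (val C :&: val C') y ->
  exists2 t, 0 <= t & y = x + t *: (x' - x).
Proof.
move=> ex xC xC' /fintype.subsetP Sy; have PC' := exchange_notin ex.
have /source_fullP/(_ P)[P0 P0S PP0] := exchange_full ex.
have Sx Q : Q \in val C :&: val C' -> Q \in argmin h x.
  by rewrite xC inE => /andP[].
have Sx' Q : Q \in val C :&: val C' -> Q \in argmin h x'.
  by rewrite xC' inE => /andP[].
have P0P : same_source P0 P by rewrite same_source_sym.
have Px : weight h x P = weight h x P0.
  apply: (argmin_eq _ (Sx _ P0S) PP0); rewrite xC.
  by case: ex.
have Px' : 0 < weight h x' P - weight h x' P0.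
  rewrite subr_gt0 lt_neqAle; have /argminP/(_ P P0P) -> := Sx' _ P0S.
  rewrite andbT; apply: contra PC' => /eqP e; rewrite -xC'.
  by apply: (argmin_weight (Sx' _ P0S)).
pose t := (weight h y P - weight h y P0) / (weight h x' P - weight h x' P0).
exists t.
  rewrite divr_ge0 ?(ltW Px') // subr_ge0.
  by have /argminP/(_ P P0P) := Sy _ P0S.
suff /eqP : (y - x) - t *: (x' - x) = 0.
  by rewrite subr_eq0 subr_eq => /eqP ->; rewrite addrC.
apply: (maxclique_rigid hadm (C := C)).
have pE Q : pairing Q ((y - x) - t *: (x' - x)) =
    (weight h y Q - weight h x Q) - t * (weight h x' Q - weight h x Q).
  by rewrite pairingB pairingZ !(pairing_sub h).
have eqS A B : A \in val C :&: val C' -> B \in val C :&: val C' ->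
    same_source A B -> pairing A ((y - x) - t *: (x' - x)) =
    pairing B ((y - x) - t *: (x' - x)).
  move=> AS BS AB; rewrite !pE (argmin_eq (Sx _ AS) (Sx _ BS) AB).
  rewrite (argmin_eq (Sx' _ AS) (Sx' _ BS) AB).
  by rewrite (argmin_eq (Sy _ AS) (Sy _ BS) AB).
have eqP0 : pairing P ((y - x) - t *: (x' - x)) =
    pairing P0 ((y - x) - t *: (x' - x)).
  rewrite !pE Px /t; field; exact: lt0r_neq0.
move=> A B AC BC AB.
case: (exchange_mem ex AC) (exchange_mem ex BC) => [eA|AS] [eB|BS].
- by rewrite eA eB.
- rewrite eA eqP0; apply: eqS => //.
  by apply: (same_source_trans (Q := P)); rewrite // -eA.
- rewrite eB eqP0; apply: eqS => //.
  by apply: same_source_trans PP0; rewrite -eB.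
- exact: eqS.
Qed.

Lemma exchange_segment C C' P P' x x' y : exchange C C' P P' ->
  argmin h x = val C -> argmin h x' = val C' -> cell (val C :&: val C') y ->
  exists t, 0 <= t <= 1 /\ y = x + t *: (x' - x).
Proof.
move=> ex xC xC' Sy; have [t t0 yt] := exchange_line ex xC xC' Sy.
rewrite finset.setIC in Sy.
have [s s0 ys] := exchange_line (exchange_sym ex) xC' xC Sy.
exists t; split=> //; rewrite t0 /=.
(* Both ends give a coordinate of y on the line; the two add up to 1. *)
have : (t + s - 1) *: (x' - x) = 0.
  have -> : (t + s - 1) *: (x' - x) =
      (x + t *: (x' - x)) - (x' + s *: (x - x')).
    rewrite -(opprB x' x) scalerN !scalerDl scaleN1r opprB opprD opprK.
    by rewrite [RHS]addrACA [in LHS]addrC -addrA [_ + (- x' + _)]addrA.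
  by rewrite -yt -ys subrr.
move/eqP; rewrite scaler_eq0 [x' - x == 0]subr_eq0 => /orP[/eqP ts|/eqP e].
  by lra.
case: ex => /eqP[]; apply: (point_inj (x := x) xC).
by rewrite -e.
Qed.

(** The point of [D] lies on the segment. If it is not the end [x'], the gap of
    a route of [D] is an affine function, nonnegative at both ends and zero at
    a point other than [x'], hence zero at [x]; so [D] is included in [C]. *)
Lemma exchange_cliques C C' P P' D : exchange C C' P P' ->
  val C :&: val C' \subset val D -> D = C \/ D = C'.
Proof.
move=> ex SD; have [x xC] := maxclique_point hadm C.
have [x' xC'] := maxclique_point hadm C'; have [y yD] := maxclique_point hadm D.
have Sy : cell (val C :&: val C') y by rewrite /cell /= yD.
have [t [/andP[t0 t1] yt]] := exchange_segment ex xC xC' Sy.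
case: (eqVneq t 1) => [e1|n1].
  right; apply: (point_inj (x := x') _ xC'); rewrite -yD yt e1 scale1r.
  by rewrite addrC subrK.
left; apply: maxclique_subset; apply/fintype.subsetP => Q QD.
have /source_fullP/(_ Q)[Q0 Q0S QQ0] := exchange_full ex.
have Q0D : Q0 \in argmin h y by rewrite yD (fintype.subsetP SD).
move: Q0S; rewrite inE -xC -xC' => /andP[Q0x Q0x'].
rewrite -yD in QD; have := argmin_eq QD Q0D QQ0.
have Q0Q : same_source Q0 Q by rewrite same_source_sym.
have /argminP/(_ Q Q0Q) gx := Q0x; have /argminP/(_ Q Q0Q) gx' := Q0x'.
rewrite yt !weight_line !(pairing_sub h) => e.
apply: (argmin_weight Q0x Q0Q); apply/le_anti; rewrite gx andbT.
rewrite -subr_le0 -(pmulr_rle0 _ (_ : 0 < 1 - t)); last first.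
  by rewrite subr_gt0 lt_neqAle n1 t1.
have -> : (1 - t) * (weight h x Q - weight h x Q0) =
    t * (weight h x' Q0 - weight h x' Q).
  by move: e; lra.
by rewrite mulr_ge0_le0 // subr_le0.
Qed.

Lemma flip_cliques C C' D : flip_lt C C' ->
  val C :&: val C' \subset val D -> D = C \/ D = C'.
Proof. by move=> /flip_exchange[P [P' ex]]; apply: exchange_cliques ex. Qed.

(** * Dimension of cells *)
Lemma has_dim0P (c : set point) : has_dim c 0 <-> exists x, c = [set x].
Proof.
split=> [[x cx [V dV VP]]|[x ->]].
  exists x; apply/seteqP; split=> y /=; last by move=> ->.
  move/eqP: dV; rewrite dimv_eq0 => /eqP V0.
  have /VP/(_ y) := subvv V; rewrite V0 memv0 subr_eq0 => H.
  by move=> /H /eqP.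
exists x => //; exists 0%VS; first exact: dimv0.
by move=> W; split=> [_ y ->|_]; rewrite ?subrr ?mem0v ?sub0v.
Qed.

Lemma has_dim1_segment (c : set point) x x' : c x -> c x' -> x != x' ->
  (forall y, c y -> exists t, y = x + t *: (x' - x)) -> has_dim c 1.
Proof.
move=> cx cx' nx line; exists x => //; exists <[x' - x]>%VS.
  by rewrite dim_vline subr_eq0 eq_sym nx.
move=> W; split=> [sW y cy|inW].
  have [t ->] := line y cy; rewrite addrC addKr; apply: memvZ.
  by apply: (subvP sW); apply: memv_line.
by rewrite -memvE; apply: inW.
Qed.

Lemma has_dim1_line (c : set point) x x' y : has_dim c 1 -> c x -> c x' ->
  x != x' -> c y -> exists t, y = x + t *: (x' - x).
Proof.
case=> x0 cx0 [V dV VP] cx cx' nx cy.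
have inV z : c z -> z - x0 \in V by move=> cz; have /VP/(_ z cz) := subvv V.
have inV2 z z' : c z -> c z' -> z - z' \in V.
  move=> /inV zV /inV z'V; have -> : z - z' = (z - x0) - (z' - x0).
    by rewrite opprB addrA subrK.
  exact: rpredB.
have lV : (<[x' - x]> = V)%VS.
  apply/eqP; rewrite eqEdim dV dim_vline subr_eq0 eq_sym nx andbT.
  by rewrite -memvE inV2.
have : y - x \in <[x' - x]>%VS by rewrite lV inV2.
by move=> /vlineP[t e]; exists t; rewrite -e addrC subrK.
Qed.

(** Suppose that [A] and [B] are two routes of [C] outside [C']. Removing [B]
    from [C] gives a clique containing [T], whose point [x1] is on the line and
    differs from [x]. The gap of [A] vanishes at [x] and at [x1], hence
    everywhere on the line, and [A] is minimal at [x'] as well. *)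
Lemma adjacent_new C C' x x' T A B : argmin h x = val C ->
  argmin h x' = val C' -> x != x' -> source_full T -> has_dim (cell T) 1 ->
  cell T x -> cell T x' ->
  A \in val C -> A \notin val C' -> B \in val C -> B \notin val C' -> A = B.
Proof.
move=> xC xC' nx fT dT Tx Tx' AC AC' BC BC'; apply/eqP/negPn/negP => nAB.
(* B is not in T, because T is included in C'. *)
have TC : T \subset (val C :\ B)%SET.
  apply/fintype.subsetP => Q QT; rewrite !inE -xC (fintype.subsetP Tx) // andbT.
  by apply: contraNneq BC' => <-; rewrite -xC' (fintype.subsetP Tx').
have fS := source_fullS TC fT.
have cS : clique F (val C :\ B).
  by apply: clique_sub (maxclique_clique C); apply: subD1set.
have [x1 _ /(_ fS) x1S] := clique_point hadm (source_full_neq0 fS) cS.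
have Tx1 : cell T x1 by rewrite /cell /= x1S.
have [t e1] := has_dim1_line dT Tx Tx' nx Tx1.
have t0 : t != 0.
  apply/eqP => t0; move: e1; rewrite t0 scale0r addr0 => e1.
  by have := BC; rewrite -xC -e1 x1S !inE eqxx.
have /source_fullP/(_ A)[A0 A0T AA0] := fT.
have A0A : same_source A0 A by rewrite same_source_sym.
have A1 : A \in argmin h x1 by rewrite x1S !inE nAB.
rewrite -xC in AC.
have ex := argmin_eq AC ((fintype.subsetP Tx) _ A0T) AA0.
have := argmin_eq A1 ((fintype.subsetP Tx1) _ A0T) AA0.
rewrite e1 !weight_line !(pairing_sub h) ex => /addrI /(mulfI t0) /addIr e.
by case/negP: AC'; rewrite -xC' (argmin_weight ((fintype.subsetP Tx') _ A0T)).
Qed.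

Lemma adjacent_exchange C C' x x' T : C != C' -> argmin h x = val C ->
  argmin h x' = val C' -> source_full T -> has_dim (cell T) 1 ->
  cell T x -> cell T x' -> exists P P', exchange C C' P P'.
Proof.
move=> nCC xC xC' fT dT Tx Tx'.
have nx : x != x'.
  apply: contra nCC => /eqP e; rewrite -e in xC'.
  exact/eqP/(point_inj xC xC').
have new D D' : D != D' -> exists2 P, P \in val D & P \notin val D'.
  move=> nD; apply/subsetPn; apply: contra nD => sD.
  exact/eqP/maxclique_subset.
have nCC' : C' != C by rewrite eq_sym.
have [P PC PC'] := new _ _ nCC; have [P' P'C P'C'] := new _ _ nCC'.
exists P, P'; split=> // Q QC; apply: contraNT => QC'; apply/eqP.
  exact: (adjacent_new xC xC' nx fT dT Tx Tx' QC QC' PC PC').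
by apply: (adjacent_new xC' xC _ fT dT Tx' Tx QC QC' P'C P'C'); rewrite eq_sym.
Qed.

End Exchange.

(** * The cells of the tropical framingtope *)
Section Cells.
Variables (R : realType) (n : nat) (G : flowGraph n) (F : framing G).
Variable h : route G -> R.
Hypothesis hadm : admissible F h.
Notation point := (trop_point R F).
Implicit Types (P Q : route G) (S T : {set route G}) (x y d : point).
Implicit Types (C D : maxclique F).

Lemma edges_of_prepend (a : source_edge G) (p : tail_route a) :
  edges_of (prepend p) = val a :: val (val p).
Proof. by []. Qed.

Lemma trop_termE (a : source_edge G) x (p : tail_route a) :
  trop_term h x p = weight h x (prepend p).
Proof.
congr (_ + _); apply: eq_bigr => i _; congr (_%:R * _).
have ia : val i != val a.
  by have /andP[ti _] := valP i; apply: contraNneq ti => ->; apply: (valP a).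
by rewrite edges_of_prepend in_cons (negPf ia).
Qed.

Lemma prepend_source (a : source_edge G) (p : tail_route a) :
  ohead (edges_of (prepend p)) = Some (val a).
Proof. by []. Qed.

Lemma route_prepend (a : source_edge G) Q :
  ohead (edges_of Q) = Some (val a) -> exists p : tail_route a, prepend p = Q.
Proof.
have [b [q [eQ tb tq]]] := route_cons Q; rewrite eQ => oQ.
have ba : b = val a by case: oQ.
have wQ := edges_of_walk Q; rewrite eQ ba in wQ.
case/andP: (wQ) => _ wq.
have sq : (size q <= n.+1)%N by apply: walk_size_max wq.
have aq : all (mem (tail_graph a)) q.
  apply/allP => e eq; rewrite !inE; apply/andP; split.
    by apply: contraTneq eq => ->; apply: walk_notin wq.
  by apply/existsP; exists Q; rewrite eQ -ba /= eqxx mem_behead.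
have pP : walk (head (val a)) (Bseq sq) ord_max
    && all (mem (tail_graph a)) (Bseq sq).
  by apply/andP; split; [apply: wq|apply: aq].
by exists (exist _ (Bseq sq) pP); apply: edges_of_inj; rewrite eQ ba.
Qed.

Lemma attains_minP (a : source_edge G) x (p : tail_route a) :
  attains_min h x p <-> prepend p \in argmin h x.
Proof.
split=> [m|/argminP m q]; last first.
  by rewrite !trop_termE; apply: m; rewrite /same_source !prepend_source.
apply/argminP => Q; rewrite /same_source prepend_source eq_sym => /eqP oQ.
by have [q <-] := route_prepend oQ; have := m q; rewrite !trop_termE.
Qed.

Lemma source_edgeP P : exists (a : source_edge G) (p : tail_route a),
  prepend p = P.
Proof.
have [b [q [eP tb _]]] := route_cons P.
have tb' : tail b == ord0 by apply/eqP.
have [|p pP] := @route_prepend (exist _ b tb') P; first by rewrite eP.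
by exists (exist _ b tb'), p.
Qed.

Lemma tail_route_exists (a : source_edge G) : inhabited (tail_route a).
Proof.
have [z /andP[wz _]] := top_walk_exists F (head (val a)).
have [|Q eQ] := @walk_route _ G (val a :: z); first by rewrite /= (valP a).
by have [|p _] := @route_prepend a Q; [rewrite eQ|constructor].
Qed.

(** A choice of one cell for each source edge is a set of routes with at least
    one route for each source; it is a clique when the cells have a common
    point. *)
Lemma trop_cellsP (c : set point) : trop_cells h c <->
  exists S, [/\ source_full S, clique F S & c = cell h S].
Proof.
split=> [[[x0 cx0] [D DP eD]]|[S [fS cS ->]]].
  have exA : forall a, exists A : {set tail_route a},
      A != finset.set0
      /\ D a = (fun x => forall p, p \in A -> attains_min h x p).
    by move=> a; have [_ [A A0 eA]] := DP a; exists A.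
  pose A a := projT1 (cid (exA a)).
  have AP a : A a != finset.set0 /\
      D a = (fun x => forall p, p \in A a -> attains_min h x p).
    exact: projT2 (cid (exA a)).
  pose S := [set P | `[< exists a (p : tail_route a),
                         p \in A a /\ prepend p = P >]]%SET.
  have cE : c = cell h S.
    rewrite eD; apply/seteqP; split=> x /=.
      move=> Dx; apply/fintype.subsetP => P.
      rewrite inE => /asboolP[a [p [pA <-]]].
      by apply/attains_minP; have := Dx a I; rewrite (AP a).2; apply.
    move=> /fintype.subsetP Sx a _; rewrite (AP a).2 => p pA.
    by apply/attains_minP/Sx; rewrite inE; apply/asboolP; exists a, p.
  exists S; split=> //.
    apply/source_fullP => P; have [a [p <-]] := source_edgeP P.
    have /set0Pn[q qA] := (AP a).1; exists (prepend q).
      by rewrite inE; apply/asboolP; exists a, q.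
    by rewrite /same_source !prepend_source.
  by rewrite cE in cx0; apply: clique_sub cx0 (clique_argmin hadm x0).
have [x Sx _] := clique_point hadm (source_full_neq0 fS) cS.
pose A (a : source_edge G) := [set p : tail_route a | prepend p \in S]%SET.
split; first by exists x.
exists (fun a => fun x => forall p, p \in A a -> attains_min h x p).
  move=> a; split.
    exists x => p; rewrite inE => pS; apply/attains_minP.
    exact: (fintype.subsetP Sx).
  exists (A a) => //; apply/set0Pn; have [p] := tail_route_exists a.
  have /source_fullP/(_ (prepend p))[Q QS] := fS.
  rewrite /same_source prepend_source eq_sym => /eqP /route_prepend[q eq].
  by exists q; rewrite inE eq.
apply/seteqP; split=> y /=.
  move=> /fintype.subsetP Sy a _ p; rewrite inE => pS; apply/attains_minP.
  exact: Sy.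
move=> Ay; apply/fintype.subsetP => P PS; have [a [p eP]] := source_edgeP P.
by rewrite -eP; apply/attains_minP; apply: (Ay a I); rewrite inE eP.
Qed.

Lemma cell_maxclique C x : argmin h x = val C -> cell h (val C) = [set x].
Proof.
move=> xC; apply/seteqP; split=> y /=; last by move=> ->; rewrite /cell /= xC.
by move=> Cy; apply: (point_uniq hadm (C := C) Cy); rewrite xC.
Qed.

Lemma bounded_segment (c : set point) x d :
  (forall y, c y -> exists t, 0 <= t <= 1 /\ y = x + t *: d) -> bounded_pts c.
Proof.
move=> seg; exists (\sum_i (`|x i : R| + `|d i : R|)) => y cy i.
have [t [/andP[t0 t1] ->]] := seg y cy.
rewrite (bigD1 i) //= !ffunE; apply: (@le_trans _ _ (`|x i : R| + `|d i : R|)).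
  apply: le_trans (ler_normD _ _) _; rewrite lerD2l normrM ger0_norm //.
  by rewrite ler_piMl.
by rewrite lerDl sumr_ge0 // => j _; rewrite addr_ge0.
Qed.

(** If [cell S] is a single point, extending [S] to a maximal clique does not
    change its cell, which remains nonempty. *)
Lemma framingtope_vertexP (c : set point) : framingtope_cells h 0 c <->
  exists C x, argmin h x = val C /\ c = [set x].
Proof.
split=> [[[/trop_cellsP[S [fS cS eS]] _] /has_dim0P[x cx]]|[C [x [xC ->]]]].
  have [C SC] := clique_extend cS; have [y yC] := maxclique_point hadm C.
  exists C, x; split=> //; suff <- : y = x by [].
  have : c y by rewrite eS /cell /= yC.
  by rewrite cx.
split; last by apply/has_dim0P; exists x.
split; last first.
  by apply: (bounded_segment (x := x) (d := 0)) => y ->; exists 0;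
    rewrite lexx ler01 scaler0 addr0.
apply/trop_cellsP; exists (val C); split.
- exact: maxclique_full hadm C.
- exact: maxclique_clique.
- by rewrite (cell_maxclique xC).
Qed.

Lemma flip_adjacent C C' x x' : argmin h x = val C -> argmin h x' = val C' ->
  flip_lt C C' -> framingtope_adj h [set x] [set x'].
Proof.
move=> xC xC' /flip_exchange[P [P' ex]].
have nx : x != x'.
  case: ex => nCC _ _ _ _; apply: contra nCC => /eqP e.
  by rewrite -e in xC'; apply/eqP/(point_inj xC xC').
have Sx : cell h (val C :&: val C') x by rewrite /cell /= xC finset.subsetIl.
have Sx' : cell h (val C :&: val C') x'.
  by rewrite /cell /= xC' finset.subsetIr.
have seg y := exchange_segment hadm ex xC xC' (y := y).
split; first by move=> /seteqP[/(_ x erefl) /= /eqP]; rewrite (negPf nx).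
exists (cell h (val C :&: val C')); split; [|by move=> _ ->|by move=> _ ->].
split; last first.
  by apply: has_dim1_segment Sx Sx' nx _ => y /seg[t [_ ->]]; exists t.
split; last exact: bounded_segment seg.
apply/trop_cellsP; exists (val C :&: val C'); split=> //.
  exact (exchange_full hadm ex).
exact: clique_sub (finset.subsetIl _ _) (maxclique_clique C).
Qed.

Lemma framingtope_adj_sym (c c' : set point) :
  framingtope_adj h c c' -> framingtope_adj h c' c.
Proof.
by case=> ncc [e [e1 ce c'e]]; split=> [/esym //|]; exists e.
Qed.

Lemma adjacent_flip C C' x x' : argmin h x = val C -> argmin h x' = val C' ->
  framingtope_adj h [set x] [set x'] -> flip_lt C C' \/ flip_lt C' C.
Proof.
move=> xC xC' [nx [e [[[/trop_cellsP[T [fT _ ->]] _] dT] Tx Tx']]].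
have nCC : C != C'.
  apply/eqP => eC; apply: nx; congr [set _].
  by apply: (point_uniq hadm (C := C)); rewrite ?xC ?xC' ?eC.
have [P [P' ex]] :=
  adjacent_exchange hadm nCC xC xC' fT dT (Tx x erefl) (Tx' x' erefl).
exact: exchange_flip ex.
Qed.

End Cells.

Theorem corollary3p3 (R : realType) (n : nat) (G : flowGraph n) (F : framing G)
    (h : route G -> R) (hadm : admissible F h) :
  exists f : maxclique F -> set (trop_point R F),
    set_bij [set: maxclique F] (framingtope_cells (F := F) h 0) f /\
    forall C C' : maxclique F,
      hasse_adj C C' <-> framingtope_adj h (f C) (f C').
Proof.
have [x xP] := choice (maxclique_point hadm).
have two := flip_cliques hadm.
have coverE (C C' : maxclique F) : framing_cover C C' <-> flip_lt C C'.
  by split; [apply: cover_flip_lt|exact: flip_lt_cover].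
exists (fun C => [set x C]); split.
  split=> [C _|C C' _ _ /= eC|c].
  - by apply/framingtope_vertexP => //; exists C, (x C).
  - apply: (point_inj (xP C)); suff -> : x C = x C' by [].
    by have : [set x C'] (x C) by rewrite -eC.
  - move=> /(framingtope_vertexP hadm)[C [y [yC ->]]]; exists C => //=.
    by congr [set _]; apply: (point_uniq hadm (C := C)); rewrite ?xP ?yC.
move=> C C'; split.
  case/orP=> /coverE; first exact: flip_adjacent.
  by move=> /(flip_adjacent hadm (xP C') (xP C)) /framingtope_adj_sym.
move=> /(adjacent_flip hadm (xP C) (xP C')).
by case=> /coverE cov; apply/orP; [left|right].
Qed.
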